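(* For $r\in(-1,1)$ let $b_r(z)=\frac{z-r}{1-rz}$ and for $r\in(-1,0)$ let $f_{r,-r}(z)=\frac{1}{\sqrt2}\left(b_r(z)^2,\,b_{-r}(z)^2\right)$, $z\in\mathbb{D}$. Then for $r,s\in(-1,0)$, the algebras $\mathcal{M}_{f_{r,-r}}$ and $\mathcal{M}_{f_{s,-s}}$ are isomorphic as algebras if and only if $\mathcal{M}_{f_{r,-r}}=\mathcal{M}_{f_{s,-s}}$.
   Context: $\mathbb{D}$ is the open unit disc and $\mathbb{B}_2$ the open unit ball of $\mathbb{C}^2$. For an analytic map $h:\mathbb{D}\to\mathbb{B}_2$, $\mathcal{H}_h$ denotes the reproducing kernel Hilbert space on $\mathbb{D}$ with kernel $k^h(z,w)=1/(1-\langle h(z),h(w)\rangle)$ and $\mathcal{M}_h$ its multiplier algebra (equal to $\{\varphi\circ h:\varphi\in\mathcal{M}_2\}$, where $\mathcal{M}_2$ is the multiplier algebra of the Drury–Arveson space on $\mathbb{B}_2$ with kernel $1/(1-\langle z,w\rangle)$). For these parameters, $f_{r,-r}(\mathbb{D})$ is a variety in $\mathbb{B}_2$ (an analytic disc attached to the unit sphere) whose only boundary self-crossing is $f_{r,-r}(1)=f_{r,-r}(-1)$. *)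

(* Defs.v *)
From HB Require Import structures.
From mathcomp Require Import all_boot all_order all_algebra.
From mathcomp Require Import all_classical all_reals.
From mathcomp Require Import complex.
Set Implicit Arguments. Unset Strict Implicit. Unset Printing Implicit Defensive.
Import Order.TTheory GRing.Theory Num.Theory.
Local Open Scope ring_scope.
Local Open Scope complex_scope.

(* The open unit disc D of C = R[i]. *)
Definition Disc (R : realType) : Type := {z : R[i] | `|z| < 1}.

(* b_r(z) = (z - r)/(1 - r z). *)
Definition blaschke (R : realType) (r : R) (z : R[i]) : R[i] :=
  (z - r%:C) / (1 - r%:C * z).

(* f_{r,-r}(z) = 1/sqrt 2 (b_r(z)^2, b_{-r}(z)^2), as a map D -> C^2. *)
Definition frr (R : realType) (r : R) (z : Disc R) : R[i] * R[i] :=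
  (((Num.sqrt (2 : R))^-1)%:C * (blaschke r (val z)) ^+ 2,
   ((Num.sqrt (2 : R))^-1)%:C * (blaschke (- r) (val z)) ^+ 2).

(* k^h(z,w) = 1 / (1 - <h(z), h(w)>), <a,b> = a1 conj(b1) + a2 conj(b2). *)
Definition kernel_of (R : realType) (h : Disc R -> R[i] * R[i])
  (z w : Disc R) : R[i] :=
  (1 - ((h z).1 * ((h w).1)^* + (h z).2 * ((h w).2)^*))^-1.

(* Membership of f in the reproducing kernel Hilbert space H_k on D
   (Aronszajn/Moore): f is in H_k iff for some constant c, for all finite
   families of points z_i and coefficients a_i,
   |sum_i a_i f(z_i)|^2 <= c * sum_{i,j} conj(a_i) a_j k(z_j, z_i),
   i.e. iff f is a bounded functional on the span of the kernel functions. *)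
Definition in_rkhs (R : realType) (k : Disc R -> Disc R -> R[i])
  (f : Disc R -> R[i]) : Prop :=
  exists c : R, forall (n : nat) (z : 'I_n -> Disc R) (a : 'I_n -> R[i]),
    `| \sum_(i < n) a i * f (z i) | ^+ 2
      <= c%:C * \sum_(i < n) \sum_(j < n) (a i)^* * a j * k (z j) (z i).

(* The multiplier algebra of H_k: functions phi on D with phi * H_k <= H_k. *)
Definition multiplier (R : realType) (k : Disc R -> Disc R -> R[i])
  (phi : Disc R -> R[i]) : Prop :=
  forall f, in_rkhs k f -> in_rkhs k (fun z => phi z * f z).

(* M_h, the multiplier algebra of H_h. *)
Definition Mult (R : realType) (h : Disc R -> R[i] * R[i]) :
  (Disc R -> R[i]) -> Prop := multiplier (kernel_of h).

(* Two algebras of functions on D (with pointwise operations) are isomorphic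
   as complex algebras: a bijection between them preserving sums, products
   and complex scalar multiples. *)
Definition alg_isomorphic (R : realType) (A B : (Disc R -> R[i]) -> Prop) : Prop :=
  exists Phi : (Disc R -> R[i]) -> (Disc R -> R[i]),
    [/\ (forall phi, A phi -> B (Phi phi)),
        (forall phi psi, A phi -> A psi -> Phi phi = Phi psi -> phi = psi),
        (forall chi, B chi -> exists2 phi, A phi & Phi phi = chi) &
      [/\ (forall phi psi, A phi -> A psi ->
           Phi (fun z => phi z + psi z) = (fun z => Phi phi z + Phi psi z)),
        (forall phi psi, A phi -> A psi ->
           Phi (fun z => phi z * psi z) = (fun z => Phi phi z * Phi psi z)) &
        (forall (c : R[i]) phi, A phi ->
           Phi (fun z => c * phi z) = (fun z => c * Phi phi z))]].

(* Main.v *)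
(* The two multiplier algebras are always equal. With [a = r^2], [t = z w^*]
   and [zt = z^2], the kernel of [frr r] is, up to a rank-one factor, the sum of
   a part even in [z] and a part odd in [z], both expressed through the kernels
   [X = 1 - zt zt^*] and [Pi = (1 - zt) (1 - zt)^*]. The even part is comparable
   to the Szego kernel [1 / X], and the odd part to [t Pi / (X (X + c Pi))] for
   any [c > 0]; comparability of two kernels means that each is dominated, in
   the order of positive kernels, by a multiple of the other. So up to
   multiplication by a nonvanishing function the Hilbert space does not depend
   on [r], and neither does its multiplier algebra. Each domination reduces to
   an identity writing [c k' - k] as a sum of products of positive kernels. *)

Require Import Defs.
From HB Require Import structures.
From mathcomp Require Import all_boot all_order all_algebra.
From mathcomp Require Import all_classical all_reals.
From mathcomp Require Import complex.
From mathcomp Require Import zify ring lra spectral.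
Import Order.TTheory GRing.Theory Num.Theory.
Local Open Scope ring_scope.
Set Implicit Arguments.
Unset Strict Implicit.
Unset Printing Implicit Defensive.

(** The factor [X] is not a positive kernel, so no domination may be multiplied by it; every
    identity has to be assembled from positive pieces such as [Pi], [Th], [M], [1 / X], [Even] and
    [Odd]. The hard direction is to bound [Even] from below by [1 / X]. It needs [zt] and
    [1 / theta] to be bounded multipliers. Both are obtained from [beta = b_r b_{-r}], a Moebius
    function of [z^2] that is an affine combination of [u + v] and [u v], where [u = b_r^2] and
    [v = b_{-r}^2] are multipliers by construction of the kernel. To invert [1 + p beta] for
    [|p| < 1] a bound on the multiplier norm of [beta] is not enough: its powers must grow slowly.
    The binomial expansion of [L^(2 n)], where [L] is the inner product of the values of [frr r],
    bounds the squared norm of [beta^(2 n)] by [4^n / 'C(2 n, n) <= 2 n + 1]. Averaging over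
    [z |-> - z] carries the even multipliers to [Even]. The lower bound itself starts from the
    partial fractions [1 / X = kT c + c Pi kModel c]; it remains to dominate [Pi Odd] by [Even],
    which is done first with an additional factor [Pi]. *)

Lemma bernoulli_le (R : realType) (x : R) n : 0 <= x -> 1 + n%:R * x <= (1 + x) ^+ n.
Proof.
move=> x0; elim: n => [|n IH]; first by rewrite mul0r addr0 expr0.
rewrite exprSr; apply: le_trans (_ : (1 + n%:R * x) * (1 + x) <= _); last first.
  by rewrite ler_wpM2r // addr_ge0.
have := ler0n R n; rewrite -natr1; nra.
Qed.

(** Bernoulli for [1 / sqrt p = 1 + d] gives [m d (sqrt p)^m <= 1]. Squaring yields
    [m^2 d^2 p^m <= 1], so the left side is at most [3 / (m d^2)]. *)
Lemma lin_expr_small (R : realType) (p e : R) : 0 <= p < 1 -> 0 < e ->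
  exists N, forall m, (N <= m)%N -> (2 * m + 1)%:R * p ^+ m <= e.
Proof.
move=> /andP[p0 p1] e0.
have [->|pn0] := eqVneq p 0.
  by exists 1%N => -[|m] // _; rewrite expr0n /= mulr0 ltW.
have pp : 0 < p by rewrite lt_def pn0.
pose s := Num.sqrt p; have s0 : 0 < s by rewrite sqrtr_gt0.
have ss : s * s = p by rewrite -expr2 sqr_sqrtr.
have s1 : s < 1 by rewrite ltNge; apply/negP => h; nra.
pose d := s^-1 - 1; have d0 : 0 < d by rewrite subr_gt0 invf_gt1.
pose K := 3 / (e * (d * d)).
have K0 : 0 < K by rewrite divr_gt0 // ?mulr_gt0.
exists (Num.bound K) => m hm.
have Km : K < m%:R.
  by apply: lt_le_trans (archi_boundP (ltW K0)) _; rewrite ler_nat.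
have m1 : 1 <= m%:R :> R by rewrite (ler_nat R 1 m) -(ltr_nat R); apply: lt_trans Km.
have B := bernoulli_le m (ltW d0).
have dE : 1 + d = s^-1 by rewrite /d addrC subrK.
rewrite dE exprVn in B.
have sm : 0 < s ^+ m by rewrite exprn_gt0.
have {}B : (m%:R * d) * s ^+ m <= 1.
  rewrite -ler_pdivlMr // mul1r; apply: le_trans B; lra.
have Kd : 3 <= e * (d * d) * m%:R.
  by rewrite mulrC -ler_pdivrMr ?mulr_gt0 // ltW.
rewrite -ss exprMn natrD natrM.
set q := s ^+ m in sm B *; set M := m%:R in m1 B Kd *.
have M0 : 0 <= M by lra.
have v0 : 0 <= M * d * q by rewrite !mulr_ge0 // ltW.
have q2 : (M * d * q) * (M * d * q) <= 1 by rewrite mulr_ile1.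
have M3 : 2 * M + 1 <= 3 * M by lra.
have : (2 * M + 1) * (q * q) <= 3 * M * (q * q) by rewrite ler_wpM2r // mulr_ge0 // ltW.
move=> h; apply: le_trans h _.
have qq : 0 <= M * (q * q) by rewrite !mulr_ge0 // ltW.
have : 3 * (M * (q * q)) <= e * (d * d) * M * (M * (q * q)) by rewrite ler_wpM2r.
move=> h; rewrite -mulrA; apply: le_trans h _.
have -> : e * (d * d) * M * (M * (q * q)) = e * ((M * d * q) * (M * d * q)) by ring.
by rewrite -{2}[e]mulr1 ler_wpM2l // ltW.
Qed.

(** * Null sequences in [R[i]] *)

Section NullSequences.
Variable R : realType.
Local Notation C := R[i].

Definition null_seq (u : nat -> C) : Prop := forall e : R, 0 < e ->
  exists N, forall m, (N <= m)%N -> `|u m| <= e%:C%C.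

Lemma null_seqD u v : null_seq u -> null_seq v -> null_seq (fun m => u m + v m).
Proof.
move=> hu hv e e0; have e2 : 0 < e / 2 by rewrite divr_gt0.
have [N hN] := hu _ e2; have [N' hN'] := hv _ e2.
exists (maxn N N') => m; rewrite geq_max => /andP[h h'].
apply: le_trans (ler_normD _ _) _; rewrite [e]splitr rmorphD /=.
by apply: lerD; [apply: hN | apply: hN'].
Qed.

Lemma null_seqZ c u : null_seq u -> null_seq (fun m => c * u m).
Proof.
move=> hu e e0; have c0 : 0 < Normc.normc c + 1 by rewrite ltr_wpDl //; case: c => ? ?; apply: sqrtr_ge0.
have [N hN] := hu _ (divr_gt0 e0 c0); exists N => m /hN h.
rewrite normrM -[X in _ <= X](_ : (Normc.normc c + 1)%:C%C * (e / (Normc.normc c + 1))%:C%C = _).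
  by apply: ler_pM => //; rewrite rmorphD /= lerDl ler01.
by rewrite -rmorphM /= mulrC divfK // gt_eqF.
Qed.

Lemma null_seq_sum (I : Type) (r : seq I) (u : I -> nat -> C) :
  (forall i, null_seq (u i)) -> null_seq (fun m => \sum_(i <- r) u i m).
Proof.
move=> hu; elim: r => [|i r IH] e e0.
  by exists 0%N => m _; rewrite big_nil normr0 ler0c ltW.
have [N hN] := null_seqD (hu i) IH e0; exists N => m /hN.
by rewrite big_cons.
Qed.

Lemma null_seqX (x : C) : `|x| < 1 -> null_seq (fun m => x ^+ m).
Proof.
move=> x1 e e0; pose p := Normc.normc x.
have ex : `|x| = p%:C%C by [].
have p01 : 0 <= p < 1 by rewrite -ler0c -ltcR -ex normr_ge0.
have [N hN] := lin_expr_small p01 e0; exists N => m /hN h.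
rewrite normrX ex -rmorphXn /= lecR; apply: le_trans h.
by rewrite ler_peMl ?exprn_ge0 // ?(andP p01).1 // (ler_nat R 1) addn1.
Qed.

Lemma normc_ge_Im (x : C) : `|complex.Im x|%:C%C <= `|x|.
Proof.
have := normc_ge_Re (x * 'i%C); rewrite ReiNIm normrN normrM.
by rewrite [X in _ * X](_ : _ = 1) ?mulr1 // normc_def /= expr0n expr1n add0r sqrtr1.
Qed.

(** In the order of [R[i]], [0 <= S] also says that [S] is real, so the limit is controlled in its
    real and imaginary parts separately. *)
Lemma null_seq_ge0 (S : C) (s : nat -> C) :
  (forall m, 0 <= s m) -> null_seq (fun m => S - s m) -> 0 <= S.
Proof.
move=> s0 h; rewrite lecE /=.
have key (e : R) : 0 < e -> (`|complex.Im S| <= e) && (- e <= complex.Re S).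
  move=> /h[N /(_ N (leqnn N))]; have := s0 N; move: (s N) => t.
  case: t => a b; case: {s0 h} S => x y; rewrite lecE /= => /andP[/eqP -> a0] hn.
  have hr := le_trans (normc_ge_Re _) hn; have hi := le_trans (normc_ge_Im _) hn.
  move: hr hi; rewrite !lecR /= subr0 => hr ->.
  by move: hr; rewrite ler_norml => /andP[hr _]; lra.
apply/andP; split.
  rewrite -normr_eq0 eq_le normr_ge0 andbT.
  by apply/ler_addgt0Pl => e /key /andP[]; rewrite addr0.
apply/ler_addgt0Pl => e /key /andP[_]; lra.
Qed.

End NullSequences.

(** * Positive kernels *)

Section PositiveKernels.
Variables (R : realType) (T : Type).
Local Notation C := R[i].
Implicit Types (k A B : T -> T -> C) (f : T -> C).

(** The inequality in [R[i]] includes that the form is real; Hermitian symmetry is therefore a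
    consequence ([psd_herm]). The indexing agrees with that of [in_rkhs]. *)
Definition psd k : Prop := forall n (z : 'I_n -> T) (a : 'I_n -> C),
  0 <= \sum_(i < n) \sum_(j < n) (a i)^* * a j * k (z j) (z i).

Lemma eq_psd {A} B : (forall z w, A z w = B z w) -> psd A -> psd B.
Proof.
move=> eAB pA n z a; apply: le_trans (pA n z a) _; rewrite le_eqVlt.
by apply/orP; left; apply/eqP; do 2!apply: eq_bigr => ? _; rewrite eAB.
Qed.

Lemma psdD A B : psd A -> psd B -> psd (fun z w => A z w + B z w).
Proof.
move=> pA pB n z a; apply: le_trans (addr_ge0 (pA n z a) (pB n z a)) _.
rewrite -big_split /= le_eqVlt; apply/orP; left; apply/eqP/eq_bigr => i _.
by rewrite -big_split; apply: eq_bigr => j _; rewrite mulrDr.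
Qed.

Lemma psdZ (c : C) A : 0 <= c -> psd A -> psd (fun z w => c * A z w).
Proof.
move=> c0 pA n z a; apply: le_trans (mulr_ge0 c0 (pA n z a)) _.
rewrite mulr_sumr le_eqVlt; apply/orP; left; apply/eqP/eq_bigr => i _.
by rewrite mulr_sumr; apply: eq_bigr => j _; ring.
Qed.

Lemma psd_congr f A : psd A -> psd (fun z w => f z * (f w)^* * A z w).
Proof.
move=> pA n z a; apply: le_trans (pA n z (fun i => a i * f (z i))) _.
rewrite le_eqVlt; apply/orP; left; apply/eqP.
by do 2!apply: eq_bigr => ? _; ring.
Qed.

Lemma psd1 : psd (fun _ _ => 1).
Proof.
move=> n z a.
have -> : \sum_(i < n) \sum_(j < n) (a i)^* * a j * 1 =
    (\sum_(i < n) a i) * (\sum_(i < n) a i)^*.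
  rewrite mulrC rmorph_sum mulr_suml; apply: eq_bigr => i _.
  by rewrite mulr_sumr; apply: eq_bigr => j _; rewrite mulr1.
exact: mul_conjC_ge0.
Qed.

Lemma psd_cst (c : C) : 0 <= c -> psd (fun _ _ => c).
Proof. by move=> c0; apply: eq_psd (psdZ c0 psd1) => z w; rewrite mulr1. Qed.

Lemma psd_rank1 f : psd (fun z w => f z * (f w)^*).
Proof. by apply: eq_psd (psd_congr f psd1) => z w; rewrite mulr1. Qed.

Lemma psd_sum (I : Type) (r : seq I) (P : pred I) (F : I -> T -> T -> C) :
  (forall i, P i -> psd (F i)) -> psd (fun z w => \sum_(i <- r | P i) F i z w).
Proof.
move=> pF; elim: r => [|i r IH].
  by apply: eq_psd (psd_cst (lexx 0)) => z w; rewrite big_nil.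
have [Pi|nPi] := boolP (P i).
  by apply: eq_psd (psdD (pF i Pi) IH) => z w; rewrite big_cons Pi.
by apply: eq_psd IH => z w; rewrite big_cons (negbTE nPi).
Qed.

Lemma psd_diag k z : psd k -> 0 <= k z z.
Proof.
move=> pk; have := pk 1 (fun=> z) (fun=> 1).
by rewrite !big_ord1 rmorph1 !mul1r.
Qed.

Lemma psd2 k z w a b : psd k ->
  0 <= a^* * a * k z z + a^* * b * k w z + b^* * a * k z w + b^* * b * k w w.
Proof.
move=> pk; have := pk 2 (fun i => if i == ord0 then z else w)
  (fun i => if i == ord0 then a else b).
by rewrite !big_ord_recl !big_ord0 /= !addr0 !addrA.
Qed.

(** The form is real at coefficients [(1, 1)] and [(1, i)]; its imaginary parts there compare the
    imaginary and the real parts of [k z w] and [k w z]. *)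
Lemma psd_herm k z w : psd k -> (k z w)^* = k w z.
Proof.
move=> pk; have zz := psd_diag z pk; have ww := psd_diag w pk.
have := psd2 z w 1 1 pk; have := psd2 z w 1 'i%C pk.
move: zz ww; case: (k z z) (k z w) (k w z) (k w w) => [a a'] [b b'] [c c'] [d d'].
rewrite !lecE /= => /andP[/eqP -> _] /andP[/eqP -> _].
rewrite !(mul0r, mul1r, mulr0, mulr1, oppr0, opprK, mulN1r, mulNr, mulrN, add0r, addr0, subr0, sub0r).
move=> /andP[/eqP h1 _] /andP[/eqP h2 _].
by apply/eqP; rewrite eq_complex /=; apply/andP; split; apply/eqP; lra.
Qed.

Lemma mulc_conj (x : C) : x * x^* = `|x| ^+ 2.
Proof. by rewrite normCK. Qed.

Lemma conj_ge0_id (x : C) : 0 <= x -> x^* = x.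
Proof. by move=> x0; apply/CrealP/ger0_real. Qed.

(** Choosing the second coefficient as minus the phase of [k z w] gives
    [2 |k z w| <= k z z + k w w]. *)
Lemma psd_lt1 k : psd k -> (forall z, k z z < 1) -> forall z w, `|k z w| < 1.
Proof.
move=> pk k1 z w; set c := k z w.
have [->|c0] := eqVneq c 0; first by rewrite normr0.
have nc0 : `|c| != 0 by rewrite normr_eq0.
have cn : `|c|^* = `|c| by apply: conj_ge0_id.
have wz : k w z = c^* by rewrite psd_herm.
have cc : c * c^* = `|c| ^+ 2 by apply: mulc_conj.
move: nc0 cn cc; move: `|c| => m nc0 cn cc.
have := psd2 z w 1 (- (c / m)) pk; rewrite wz -/c.
have -> : 1^* * 1 * k z z + 1^* * - (c / m) * c^* + (- (c / m))^* * 1 * c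
    + (- (c / m))^* * - (c / m) * k w w
  = k z z + k w w * (c * c^* / m ^+ 2) - 2 * (c * c^* / m).
  by rewrite !(rmorphN, rmorphM, fmorphV, rmorph1) /= cn; field.
rewrite cc divff ?expf_neq0 // mulr1 expr2 mulfK // subr_ge0 => h.
have : 2 * m < 1 + 1 by apply: le_lt_trans h _; rewrite ltrD.
by rewrite -[1 + 1]/(2%:R) -{2}[2]mulr1 ltr_pM2l // ltr0n.
Qed.

(** Schur product theorem: diagonalising the matrix of [A] turns the form of the product into a
    combination of forms of [B] with the eigenvalues as weights. *)
Lemma psdM A B : psd A -> psd B -> psd (fun z w => A z w * B z w).
Proof.
move=> pA pB n z a; pose M : 'M[C]_n := \matrix_(i, j) A (z j) (z i).
have hM : (map_mx Num.conj M^T) = M.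
  by apply/matrixP => i j; rewrite !mxE; apply: (psd_herm _ _ pA).
have /orthomx_spectralP eM : M \is normalmx by apply/normalmxP; rewrite hM.
move: eM; set P := spectralmx M; set D := spectral_diag M => eM.
have uP : P \is unitarymx by apply: spectral_unitarymx.
rewrite invmx_unitary // in eM.
have eMij i j : A (z j) (z i) = \sum_(l < n) D 0 l * ((P l i)^* * P l j).
  have -> : A (z j) (z i) = M i j by rewrite mxE.
  rewrite eM mxE; apply: eq_bigr => l _; rewrite mul_mx_diag !mxE.
  by rewrite mulrA [_ * D 0 l]mulrC.
(* An eigenvalue is the form of [A] evaluated at the conjugate of the corresponding row of [P]. *)
have D0 l : 0 <= D 0 l.
  have := pA n z (fun i => (P l i)^*).
  have -> : \sum_(i < n) \sum_(j < n) (P l i)^*^* * (P l j)^* * A (z j) (z i)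
      = (P *m M *m map_mx Num.conj P^T) l l.
    rewrite mxE exchange_big; apply: eq_bigr => j _; rewrite !mxE mulr_suml.
    by apply: eq_bigr => i _; rewrite conjCK mxE mulrAC.
  rewrite eM !mulmxA (unitarymxP uP) mul1mx -mulmxA (unitarymxP uP) mulmx1.
  by rewrite mxE eqxx.
have -> : \sum_(i < n) \sum_(j < n) (a i)^* * a j * (A (z j) (z i) * B (z j) (z i))
  = \sum_(l < n) D 0 l * (\sum_(i < n) \sum_(j < n)
       (a i * P l i)^* * (a j * P l j) * B (z j) (z i)).
  under eq_bigr => i _ do under eq_bigr => j _ do
    rewrite eMij mulr_suml mulr_sumr.
  under eq_bigr => i _ do rewrite exchange_big /=.
  rewrite exchange_big; apply: eq_bigr => l _ /=.
  rewrite mulr_sumr; apply: eq_bigr => i _; rewrite mulr_sumr.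
  by apply: eq_bigr => j _; rewrite rmorphM /=; ring.
by apply: sumr_ge0 => l _; apply: mulr_ge0.
Qed.

Lemma psdX A n : psd A -> psd (fun z w => A z w ^+ n).
Proof.
move=> pA; elim: n => [|n IH]; first exact: psd1.
by apply: eq_psd (psdM pA IH) => z w; rewrite exprS.
Qed.

Lemma sub1_neq0 (x : C) : `|x| < 1 -> 1 - x != 0.
Proof.
by move=> x1; rewrite subr_eq0; apply: contraTneq x1 => <-; rewrite normr1 ltxx.
Qed.

(** The partial sums of the geometric series are positive, and [psd_lt1] makes the series converge
    off the diagonal too. *)
Lemma psd_geom A : psd A -> (forall z, A z z < 1) ->
  psd (fun z w => (1 - A z w)^-1).
Proof.
move=> pA A1 n z a; have lt1 := psd_lt1 pA A1.
pose F m z w := \sum_(l < m) A z w ^+ l.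
pose Q k := \sum_(i < n) \sum_(j < n) (a i)^* * a j * k (z j) (z i).
have pF m : psd (F m) by apply: psd_sum => l _; apply: psdX.
apply: (@null_seq_ge0 _ _ (fun m => Q (F m))) => [m|]; first exact: pF.
suff -> : (fun m => Q (fun z w => (1 - A z w)^-1) - Q (F m)) =
    (fun m => \sum_(i < n) \sum_(j < n) (a i)^* * a j / (1 - A (z j) (z i)) *
       A (z j) (z i) ^+ m).
  apply: null_seq_sum => i; apply: null_seq_sum => j; apply: null_seqZ.
  exact: null_seqX.
apply/funext => m; rewrite /Q -sumrB; apply: eq_bigr => i _.
rewrite -sumrB; apply: eq_bigr => j _; rewrite -mulrBr -mulrA; congr (_ * _).
have n0 := sub1_neq0 (lt1 (z j) (z i)).
have := subrX1 (A (z j) (z i)) m; rewrite -/(F m (z j) (z i)) => e.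
apply: (mulfI n0); rewrite mulrBr mulrA divff // mul1r.
have -> : (1 - A (z j) (z i)) * F m (z j) (z i) =
  - ((A (z j) (z i) - 1) * F m (z j) (z i)) by ring.
by rewrite -e; ring.
Qed.

(* With [v = (1 + e) / (1 - e)] the denominator is a multiple of
   [v z + (v w)^* + 2 c], so this is the Szego kernel of a half-plane
   containing the one that [v] maps into. *)
Lemma horo_psd (e : T -> C) (c : C) : 0 <= c -> (forall z, `|e z| < 1) ->
  let D z w : C := 1 - e z * (e w)^* + c * ((1 - e z) * (1 - e w)^*) in
  psd (fun z w => (D z w)^-1) /\ (forall z w, D z w != 0).
Proof.
move=> c0 e1 D; have cc : c^* = c by apply: conj_ge0_id.
have c1 : 1 + c != 0 by rewrite gt_eqF // ltr_wpDr.
pose g z : C := 1 + c - c * e z.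
have g1 z : 1 <= `|g z|.
  rewrite /g; have h := lerB_normD (1 + c) (- (c * e z)).
  apply: le_trans h; rewrite normrN normrM (ger0_norm c0).
  rewrite (ger0_norm (addr_ge0 ler01 c0)).
  by rewrite -addrA lerDl subr_ge0 -{2}[c]mulr1 ler_wpM2l // ltW.
have g0 z : g z != 0 by rewrite -normr_eq0 gt_eqF // (lt_le_trans _ (g1 z)).
pose f z := e z / g z.
have f1 z : f z * (f z)^* < 1.
  rewrite mulc_conj -(expr1n _ 2) ltr_pXn2r ?nnegrE // normf_div.
  by rewrite ltr_pdivrMr ?mul1r ?(lt_le_trans (e1 z)) // (lt_le_trans _ (g1 z)).
have eD z w : D z w = g z * (g w)^* / (1 + c) * (1 - f z * (f w)^*).
  have gw : (g w)^* = 1 + c - c * (e w)^* by rewrite /g !(rmorphB, rmorphD, rmorphM, rmorph1) /= cc.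
  have gw0 : 1 + c - c * (e w)^* != 0 by rewrite -gw conjC_eq0.
  have ew : (1 - e w)^* = 1 - (e w)^* by rewrite rmorphB rmorph1.
  rewrite /f /D rmorphM fmorphV /= gw ew /g.
  by field; rewrite c1 gw0 -/(g z) g0.
have n0 z w : 1 - f z * (f w)^* != 0.
  by apply: sub1_neq0; apply: (psd_lt1 (psd_rank1 f) f1).
split=> [|z w]; last first.
  by rewrite eD !mulf_neq0 ?invr_eq0 ?conjC_eq0.
have p := psd_congr (fun z => (g z)^-1) (psd_geom (psd_rank1 f) f1).
have c10 : 0 <= 1 + c by rewrite addr_ge0.
apply: eq_psd (psdZ c10 p) => z w; rewrite eD fmorphV /=.
have := n0 z w; move: (1 - _) => n n1; field.
by rewrite n1 c1 g0 conjC_eq0 g0.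
Qed.

(** This is the form of [A] on the doubled family of points [z i], [s (z i)] with repeated
    coefficients. *)
Lemma psd_symmetrize (s : T -> T) A : psd A ->
  psd (fun z w => A z w + A (s z) w + A z (s w) + A (s z) (s w)).
Proof.
move=> pA n z a.
pose f (U : Type) (b c : 'I_n -> U) (i : 'I_(n + n)) : U :=
  match fintype.split i with inl j => b j | inr j => c j end.
have := pA _ (f _ z (fun i => s (z i))) (f _ a a).
rewrite big_split_ord /=.
have fl U (b c : 'I_n -> U) i : f U b c (lshift n i) = b i.
  by rewrite /f; case: split_ordP => j /eqP; rewrite ?eq_shift // => /eqP ->.
have fr U (b c : 'I_n -> U) i : f U b c (rshift n i) = c i.
  by rewrite /f; case: split_ordP => j /eqP; rewrite ?eq_shift // => /eqP ->.
under eq_bigr => i _ do (rewrite big_split_ord /=;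
  under eq_bigr => j _ do rewrite !fl; under [X in _ + X]eq_bigr => j _ do rewrite !fr !fl).
under [X in _ + X]eq_bigr => i _ do (rewrite big_split_ord /=;
  under eq_bigr => j _ do rewrite !fl !fr; under [X in _ + X]eq_bigr => j _ do rewrite !fr).
rewrite -big_split /=; congr (_ <= _); apply: eq_bigr => i _.
by rewrite -!big_split /=; apply: eq_bigr => j _; ring.
Qed.

End PositiveKernels.

(** * Domination and bounded multipliers *)

Section Domination.
Variables (R : realType) (T : Type).
Local Notation C := R[i].
Implicit Types (A B D k : T -> T -> C) (f g : T -> C) (c : C).

Definition dom A B : Prop :=
  exists2 c, 0 <= c & psd (fun z w => c * B z w - A z w).

Lemma eq_dom A A' B B' : (forall z w, A z w = A' z w) ->
  (forall z w, B z w = B' z w) -> dom A B -> dom A' B'.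
Proof.
move=> eA eB [c c0 h]; exists c => //.
by apply: eq_psd h => z w; rewrite eA eB.
Qed.

Lemma psd_dom A B : psd (fun z w => B z w - A z w) -> dom A B.
Proof. by move=> h; exists 1 => //; apply: eq_psd h => z w; rewrite mul1r. Qed.

Lemma dom_refl A : dom A A.
Proof.
by apply: psd_dom; apply: eq_psd (psd_cst (lexx 0)) => z w; rewrite subrr.
Qed.

Lemma dom_trans B A D : dom A B -> dom B D -> dom A D.
Proof.
move=> [c c0 h] [c' c'0 h']; exists (c * c'); first exact: mulr_ge0.
by apply: eq_psd (psdD (psdZ c0 h') h) => z w; ring.
Qed.

Lemma domD A B D : dom A D -> dom B D -> dom (fun z w => A z w + B z w) D.
Proof.
move=> [c c0 h] [c' c'0 h']; exists (c + c'); first exact: addr_ge0.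
by apply: eq_psd (psdD h h') => z w; ring.
Qed.

Lemma domZ c A B : 0 <= c -> dom A B -> dom (fun z w => c * A z w) B.
Proof.
move=> c0 [d d0 h]; exists (c * d); first exact: mulr_ge0.
by apply: eq_psd (psdZ c0 h) => z w; ring.
Qed.

Lemma domZr c A B : 0 < c -> dom A B -> dom A (fun z w => c * B z w).
Proof.
move=> c0 [d d0 h]; exists (d / c); first by rewrite divr_ge0 // ltW.
by apply: eq_psd h => z w; field; rewrite gt_eqF.
Qed.

Lemma domM D A B : psd D -> dom A B ->
  dom (fun z w => D z w * A z w) (fun z w => D z w * B z w).
Proof.
move=> pD [c c0 h]; exists c => //.
by apply: eq_psd (psdM pD h) => z w; ring.
Qed.

Lemma dom_addr A B D : psd D -> dom A B -> dom A (fun z w => B z w + D z w).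
Proof.
move=> pD [c c0 h]; exists c => //.
by apply: eq_psd (psdD h (psdZ c0 pD)) => z w; ring.
Qed.

Lemma dom_gt0 A B : psd B -> dom A B ->
  exists2 c, 0 < c & psd (fun z w => c * B z w - A z w).
Proof.
move=> pB [c c0 h]; exists (c + 1); first by rewrite ltr_wpDl.
by apply: eq_psd (psdD h pB) => z w; ring.
Qed.

(** Boundedness of multiplication by [f] on the Hilbert space of [k], expressed on kernel functions,
    which are eigenvectors of the adjoint. The constant bounds the square of the norm. *)
Definition bounded_mul k f : Prop :=
  dom (fun z w => f z * (f w)^* * k z w) k.

Section BoundedMultipliers.
Variable k : T -> T -> C.
Hypothesis pk : psd k.

Lemma eq_bounded_mul f g : f =1 g -> bounded_mul k f -> bounded_mul k g.
Proof. by move=> e; apply: eq_dom => // z w; rewrite !e. Qed.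

Lemma bounded_mul_cst c : bounded_mul k (fun=> c).
Proof. by apply: domZ (dom_refl k); apply: mul_conjC_ge0. Qed.

(** Parallelogram law: [2 (|f|^2 + |g|^2) - |f + g|^2 = |f - g|^2], polarised. *)
Lemma bounded_mulD f g : bounded_mul k f -> bounded_mul k g ->
  bounded_mul k (fun z => f z + g z).
Proof.
move=> [c c0 h] [d d0 h']; have t0 : 0 <= 2 :> C by rewrite ler0n.
exists (2 * (c + d)); first by rewrite mulr_ge0 // addr_ge0.
apply: eq_psd (psdD (psdZ t0 (psdD h h')) (psd_congr (fun z => f z - g z) pk)).
by move=> z w; ring.
Qed.

Lemma bounded_mulM f g : bounded_mul k f -> bounded_mul k g ->
  bounded_mul k (fun z => f z * g z).
Proof.
move=> hf hg; apply: dom_trans hf.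
apply: eq_dom (domM (psd_rank1 f) hg) => z w //.
by rewrite rmorphM /=; ring.
Qed.

Lemma bounded_mulX f n : bounded_mul k f -> bounded_mul k (fun z => f z ^+ n).
Proof.
move=> hf; elim: n => [|n IH]; first exact: bounded_mul_cst.
by apply: eq_bounded_mul (bounded_mulM hf IH) => z; rewrite exprS.
Qed.

Lemma bounded_mul_sum (I : Type) (r : seq I) (F : I -> T -> C) :
  (forall i, bounded_mul k (F i)) -> bounded_mul k (fun z => \sum_(i <- r) F i z).
Proof.
move=> hF; elim: r => [|i r IH].
  by apply: eq_bounded_mul (bounded_mul_cst 0) => z; rewrite big_nil.
by apply: eq_bounded_mul (bounded_mulD (hF i) IH) => z; rewrite big_cons.
Qed.

Lemma bounded_mulZ c f : bounded_mul k f -> bounded_mul k (fun z => c * f z).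
Proof. by apply: bounded_mulM; apply: bounded_mul_cst. Qed.

(** The hypothesis says that [f] has multiplier norm at most [1/2]. The bound follows from [4 |1 -
    f|^2 - 1 = 2 |1 - 2 f|^2 + 4 (1/4 - |f|^2)], polarised. *)
Lemma bounded_mul_inv1B f : (forall z, 1 - f z != 0) ->
  psd (fun z w => (1 / 4 - f z * (f w)^*) * k z w) ->
  bounded_mul k (fun z => (1 - f z)^-1).
Proof.
move=> n0 h; have t0 : 0 <= 2 :> C by rewrite ler0n.
have t4 : 0 <= 4 :> C by rewrite ler0n.
exists 4 => //.
have p := psdD (psdZ t0 (psd_congr (fun z => 1 - 2 * f z) pk)) (psdZ t4 h).
apply: eq_psd (psd_congr (fun z => (1 - f z)^-1) p) => z w.
rewrite fmorphV /= !(rmorphB, rmorphM, rmorph1, rmorph_nat) /=.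
have fw : 1 - (f w)^* != 0 by rewrite -(rmorph1 Num.conj) -rmorphB /= conjC_eq0.
by field; rewrite n0 fw.
Qed.

(** With [x = - p f], the squared norm of [x^(2 n)] is at most [(2 n + 1) p^(4 n)], hence at most
    [1/4] for a suitable [n]. Then [1 / (1 - x)] is the finite sum of [x^j], [j < 2 n], divided by
    [1 - x^(2 n)], so no infinite series of multipliers is summed. *)
Lemma bounded_mul_invX f (p : R) (b : nat -> R) : (forall z, `|f z| < 1) ->
  bounded_mul k f -> `|p| < 1 ->
  (forall n, b n <= (2 * n + 1)%:R) ->
  (forall n, psd (fun z w => ((b n)%:C%C - f z ^+ (2 * n) * (f w)^* ^+ (2 * n)) * k z w)) ->
  bounded_mul k (fun z => (1 + p%:C%C * f z)^-1).
Proof.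
move=> f1 bf p1 hb h; pose P : C := p%:C%C.
have Pc : P^* = P by apply: conjc_real.
have P1 : `|P| < 1 by rewrite normc_def /= expr0n addr0 sqrtr_sqr -(rmorph1 (real_complex R)) ltcR.
have p4 : 0 <= p ^+ 4 by rewrite exprn_even_ge0.
have pp : 0 <= p ^+ 4 < 1.
  by rewrite p4 -(ger0_norm p4) normrX exprn_ilt1.
have q0 : 0 < 4^-1 :> R by rewrite invr_gt0 ltr0n.
have [n /(_ n (leqnn n)) hn] := lin_expr_small pp q0.
have n0 : (0 < n)%N.
  by case: n hn => // hn; exfalso; move: hn; rewrite muln0 add0n mul1r expr0; lra.
pose x z := - P * f z; pose g z := x z ^+ (2 * n).
have x1 z : `|x z| < 1 by rewrite normrM normrN mulr_ilt1.
have g0 z : 1 - g z != 0.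
  by apply: sub1_neq0; rewrite normrX exprn_ilt1 // muln_eq0 /= -lt0n.
have x0 z : 1 - x z != 0 by apply: sub1_neq0.
have bg : bounded_mul k (fun z => (1 - g z)^-1).
  apply: bounded_mul_inv1B => //.
  pose m : R := 4^-1 - p ^+ 4 ^+ n * b n.
  have m0 : 0 <= m%:C%C.
    rewrite ler0c subr_ge0; apply: le_trans hn; rewrite mulrC ler_wpM2r //.
    by rewrite exprn_ge0.
  have pn : 0 <= (p ^+ 4 ^+ n)%:C%C by rewrite ler0c exprn_ge0.
  apply: eq_psd (psdD (psdZ m0 pk) (psdZ pn (h n))) => z w.
  have -> : g z * (g w)^* = P ^+ 4 ^+ n * (f z ^+ (2 * n) * (f w)^* ^+ (2 * n)).
    have -> : P ^+ 4 ^+ n = P ^+ 2 ^+ n * P ^+ 2 ^+ n.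
      by rewrite -exprMn; congr (_ ^+ n); ring.
    rewrite /g /x rmorphXn rmorphM rmorphN /= Pc ![(- P * _) ^+ _]exprMn.
    by rewrite ![(- P) ^+ _]exprM sqrrN; ring.
  rewrite /m rmorphB !rmorphXn rmorphM !rmorphXn fmorphV rmorph_nat /= -/P.
  by rewrite div1r; ring.
have bs : bounded_mul k (fun z => \sum_(j < 2 * n) x z ^+ j).
  apply: bounded_mul_sum => j; apply: bounded_mulX; exact: bounded_mulZ.
apply: eq_bounded_mul (bounded_mulM bs bg) => z.
have e : 1 - g z = (1 - x z) * \sum_(j < 2 * n) x z ^+ j.
  by rewrite -opprB subrX1 -mulNr opprB.
have -> : 1 + p%:C%C * f z = 1 - x z by rewrite /x /P; ring.
have := g0 z; rewrite e => hg; rewrite invfM mulrCA divff ?mulr1 //.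
by apply: contraNneq hg => ->; rewrite mulr0.
Qed.
End BoundedMultipliers.
End Domination.

(** * The even and odd parts of the kernel *)

Section ParityKernels.
Variables (R : realType) (T : Type).
Local Notation C := R[i].
Variables (zt : T -> C) (a : C).

(* For [zt = z^2] and [a = r^2]: [evn] and [sqo] are [(u + v) / 2] and
   [((u - v) / 2)^2] where [u = b_r^2] and [v = b_{-r}^2]; with [t = z w^*],
   [1 - u u^*/2 - v v^*/2] is a rank-one multiple of [kP - t qa kPi], and
   [kX kG = kP^2 - (t qa kPi)^2]. Hence [kEven] and [t qa kPi kOdd] are the even
   and the odd part of [1 / (kP - t qa kPi)]. *)
Definition kX z w : C := 1 - zt z * (zt w)^*.
Definition kPi z w : C := (1 - zt z) * (1 - zt w)^*.
Definition theta z : C := 1 + a * zt z.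
Definition kTh z w : C := theta z * (theta w)^*.
Definition qa : C := 4 * a * (1 - a).
Definition kM z w : C := ((1 - a) ^+ 2 * kTh z w + 4 * a ^+ 3 * kPi z w) / (1 + a).
Definition kP z w : C := qa * kPi z w + kX z w * kM z w.
Definition kG z w : C :=
  kX z w * kM z w ^+ 2 + 2 * (qa * kPi z w) * kM z w + (qa * kPi z w) ^+ 2.
Definition kOdd z w : C := (kX z w * kG z w)^-1.
Definition kEven z w : C := kP z w * kOdd z w.
Definition kT c z w : C := (kX z w + c * kPi z w)^-1.
Definition kModel c z w : C := (kX z w)^-1 * kT c z w.
Definition ell z : C := (1 - a * zt z) ^+ 2.
Definition evn z : C := (zt z * (1 - a) ^+ 2 + a * (1 - zt z) ^+ 2) / ell z.
Definition sqo z : C := 4 * a * (1 - a) ^+ 2 * zt z * (1 - zt z) ^+ 2 / ell z ^+ 2.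

Hypotheses (a0 : 0 < a) (a1 : a < 1).
Hypothesis zt1 : forall z, `|zt z| < 1.
(** By the parallelogram law this expresses [|u|^2 + |v|^2 < 2]. The function [(u - v) / 2] is odd
    in [z], and only its square is a function of [zt]. *)
Hypothesis evn_sqo : forall z, `|evn z| ^+ 2 + `|sqo z| < 1.

Let ac : a^* = a. Proof. exact/conj_ge0_id/ltW. Qed.
Let ap : 0 < 1 + a. Proof. by rewrite addr_gt0. Qed.
Let am : 0 < 1 - a. Proof. by rewrite subr_gt0. Qed.
Let ap0 : 1 + a != 0. Proof. by rewrite gt_eqF. Qed.
Let am0 : 1 - a != 0. Proof. by rewrite gt_eqF. Qed.
Let an0 : a != 0. Proof. by rewrite gt_eqF. Qed.
Let qp : 0 < qa. Proof. by rewrite !mulr_gt0. Qed.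
Let q0 : qa != 0. Proof. by rewrite gt_eqF. Qed.

Lemma norm_azt z : `|a * zt z| < 1.
Proof. by rewrite normrM mulr_ilt1 // ger0_norm // ltW. Qed.

Lemma theta_neq0 z : theta z != 0.
Proof.
have := @sub1_neq0 R (- (a * zt z)); rewrite normrN opprK; apply; exact: norm_azt.
Qed.

Lemma ell_neq0 z : ell z != 0.
Proof. by rewrite /ell expf_neq0 // sub1_neq0 // norm_azt. Qed.

Lemma theta_conj w : (theta w)^* = 1 + a * (zt w)^*.
Proof. by rewrite /theta rmorphD rmorphM rmorph1 /= ac. Qed.

Lemma ell_conj w : (ell w)^* = (1 - a * (zt w)^*) ^+ 2.
Proof. by rewrite /ell rmorphXn rmorphB rmorphM rmorph1 /= ac. Qed.

Lemma evn_conj w :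
  (evn w)^* = ((zt w)^* * (1 - a) ^+ 2 + a * (1 - (zt w)^*) ^+ 2) / (ell w)^*.
Proof.
rewrite /evn rmorphM fmorphV /=; congr (_ / _).
by rewrite !(rmorphD, rmorphN, rmorphM, rmorphXn, rmorph1) /= ac.
Qed.

Lemma kPiE z w : kPi z w = (1 - zt z) * (1 - (zt w)^*).
Proof. by rewrite /kPi rmorphB rmorph1. Qed.

Lemma evn_lt1 z : `|evn z| < 1.
Proof.
rewrite -(@ltr_pXn2r _ 2) ?nnegrE ?ler01 // expr1n.
by apply: le_lt_trans (evn_sqo z); rewrite lerDl.
Qed.

(** This identity dictates the coefficients of [kM]. It exhibits [1 / kP] as a rank-one multiple of
    the Szego kernel pulled back by [evn], which gives its positivity. *)
Lemma kP_evn z w : (1 - a) * kP z w = ell z * (ell w)^* * (1 - evn z * (evn w)^*).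
Proof.
have lz := ell_neq0 z; have lw : (ell w)^* != 0 by rewrite conjC_eq0 ell_neq0.
have -> : ell z * (ell w)^* * (1 - evn z * (evn w)^*) = ell z * (ell w)^* -
    (zt z * (1 - a) ^+ 2 + a * (1 - zt z) ^+ 2) *
    ((zt w)^* * (1 - a) ^+ 2 + a * (1 - (zt w)^*) ^+ 2).
  by rewrite evn_conj /evn; field; rewrite lz lw.
rewrite ell_conj /ell /kP /kM /kTh theta_conj /theta kPiE /qa /kX.
by field.
Qed.

Lemma evn1B z : 1 - evn z = (1 - a) * (1 - zt z) * theta z / ell z.
Proof.
by rewrite /evn /theta /ell; field; rewrite sub1_neq0 // norm_azt.
Qed.

Lemma kX_neq0 z w : kX z w != 0.
Proof.
by rewrite /kX sub1_neq0 // normrM mulr_ilt1 // norm_conjC.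
Qed.

Lemma psd_kXV : psd (fun z w => (kX z w)^-1).
Proof.
have [h _] := horo_psd (lexx 0) zt1; apply: eq_psd h => z w.
by rewrite mul0r addr0.
Qed.

Lemma psd_kPi : psd kPi.
Proof. exact: psd_rank1. Qed.

Lemma psd_kTh : psd kTh.
Proof. exact: psd_rank1. Qed.

Lemma kT_denom_neq0 c z w : 0 <= c -> kX z w + c * kPi z w != 0.
Proof. by move=> c0; have [_] := horo_psd c0 zt1; apply. Qed.

Lemma psd_kT c : 0 <= c -> psd (kT c).
Proof. by move=> c0; have [] := horo_psd c0 zt1. Qed.

Lemma psd_kM : psd kM.
Proof.
have h1 : 0 <= (1 - a) ^+ 2 / (1 + a) by rewrite divr_ge0 ?exprn_ge0 // ltW.
have h2 : 0 <= 4 * a ^+ 3 / (1 + a).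
  by rewrite divr_ge0 ?mulr_ge0 ?exprn_ge0 // ltW.
apply: eq_psd (psdD (psdZ h1 psd_kTh) (psdZ h2 psd_kPi)) => z w.
by rewrite /kM; ring.
Qed.

(* [1 + a = theta + a (1 - zt)], so [|1 + a|^2 <= 2 |theta|^2 + 2 a^2 |1 - zt|^2] *)
Lemma dom_1_kM : dom (fun _ _ => 1) kM.
Proof.
have t0 : 0 <= 2 :> C by [].
have d1 : dom (fun _ _ => 1) (fun z w => kTh z w + kPi z w).
  have c0 : 0 <= ((1 + a) ^+ 2)^-1 by rewrite invr_ge0 exprn_ge0 // ltW.
  exists (2 / (1 + a) ^+ 2 * (1 + a ^+ 2)).
    by rewrite mulr_ge0 ?divr_ge0 ?addr_ge0 ?exprn_ge0 // ltW.
  have pa : 0 <= 2 * a ^+ 2 by rewrite mulr_ge0 ?exprn_ge0 // ltW.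
  have p := psdD (psd_rank1 (fun z => theta z - a * (1 - zt z)))
    (psdD (psdZ pa psd_kTh) (psdZ t0 psd_kPi)).
  apply: eq_psd (psdZ c0 p) => z w.
  have -> : (theta w - a * (1 - zt w))^* = 1 + a * (zt w)^* - a * (1 - (zt w)^*).
    by rewrite rmorphB /= theta_conj rmorphM rmorphB rmorph1 /= ac.
  by rewrite /kTh theta_conj kPiE /theta; field.
apply: dom_trans d1 _; apply: domD.
  exists ((1 + a) / (1 - a) ^+ 2); first by rewrite divr_ge0 ?exprn_ge0 // ltW.
  have h2 : 0 <= 4 * a ^+ 3 / (1 - a) ^+ 2.
    by rewrite divr_ge0 ?mulr_ge0 ?exprn_ge0 // ltW.
  by apply: eq_psd (psdZ h2 psd_kPi) => z w; rewrite /kM; field; rewrite ap0 am0.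
exists ((1 + a) / (4 * a ^+ 3)).
  by rewrite divr_ge0 ?mulr_ge0 ?exprn_ge0 // ltW.
have h2 : 0 <= (1 - a) ^+ 2 / (4 * a ^+ 3).
  by rewrite divr_ge0 ?mulr_ge0 ?exprn_ge0 // ltW.
apply: eq_psd (psdZ h2 psd_kTh) => z w; rewrite /kM; field.
by rewrite ap0 an0.
Qed.

Lemma kP_neq0 z w : kP z w != 0.
Proof.
have [_ /(_ z w)] := horo_psd (lexx 0) evn_lt1; rewrite mul0r addr0 => h.
apply/eqP => p0; have := kP_evn z w; rewrite p0 mulr0 => /esym/eqP; apply/negP.
by apply: mulf_neq0 h; apply: mulf_neq0; rewrite ?conjC_eq0 ell_neq0.
Qed.

Lemma psd_kPV : psd (fun z w => (kP z w)^-1).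
Proof.
have [h h0] := horo_psd (lexx 0) evn_lt1.
have p := psdZ (ltW am) (psd_congr (fun z => (ell z)^-1) h).
apply: eq_psd p => z w; rewrite fmorphV /= mul0r addr0.
have lz := ell_neq0 z; have lw : (ell w)^* != 0 by rewrite conjC_eq0 ell_neq0.
have := kP_evn z w; have := h0 z w; rewrite mul0r addr0.
move: (1 - _) => e e0 he; have -> : kP z w = ell z * (ell w)^* * e / (1 - a).
  by rewrite -he mulrC mulKf.
by field; rewrite e0 lz lw am0.
Qed.

Lemma sqo_conj z w : sqo z * (sqo w)^* =
  ((1 - a) * qa * kPi z w) ^+ 2 * (zt z * (zt w)^*) / (ell z * (ell w)^*) ^+ 2.
Proof.
have lz := ell_neq0 z; have lw : (ell w)^* != 0 by rewrite conjC_eq0 ell_neq0.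
have -> : (sqo w)^* =
    4 * a * (1 - a) ^+ 2 * (zt w)^* * (1 - (zt w)^*) ^+ 2 / (ell w)^* ^+ 2.
  rewrite /sqo rmorphM fmorphV rmorphXn /=; congr (_ / _).
  by rewrite !(rmorphD, rmorphN, rmorphM, rmorphXn, rmorph1, rmorph_nat) /= ac.
by rewrite /sqo kPiE /qa; field; rewrite lz lw.
Qed.

(** The square of [t qa kPi / kP], written so that its positivity is visible. The even part is
    [1 / kP] times the geometric series in [tau2]. *)
Let tau2 z w := sqo z * (sqo w)^* * (1 - evn z * (evn w)^*)^-1 ^+ 2.

Let tau2_diag z : tau2 z z < 1.
Proof.
have := evn_sqo z; rewrite /tau2 !mulc_conj => hz.
have e0 : 0 < 1 - `|evn z| ^+ 2.
  by rewrite subr_gt0; apply: le_lt_trans hz; rewrite lerDl.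
rewrite -exprMn exprn_ilt1 // ?divr_ge0 // ?(ltW e0) //.
by rewrite ltr_pdivrMr // mul1r ltrBrDl.
Qed.

Let psd_tau2 : psd tau2.
Proof.
have [h _] := horo_psd (lexx 0) evn_lt1.
have pS : psd (fun z w => (1 - evn z * (evn w)^*)^-1).
  by apply: eq_psd h => z w; rewrite mul0r addr0.
exact: psd_congr (psdX 2 pS).
Qed.

Let tau2_neq1 z w : 1 - tau2 z w != 0.
Proof. by apply: sub1_neq0; apply: psd_lt1. Qed.

(** Writing [t^2 = zt zt^* = 1 - kX] makes the difference of squares divisible by [kX]; [kG] is the
    quotient. *)
Lemma kPG z w : kP z w ^+ 2 - (qa * kPi z w) ^+ 2 * (zt z * (zt w)^*)
  = kX z w * kG z w.
Proof.
by rewrite /kG /kP /kX; ring.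
Qed.

Let kXG_tau z w : kX z w * kG z w = kP z w ^+ 2 * (1 - tau2 z w).
Proof.
rewrite -kPG /tau2 sqo_conj.
have lz := ell_neq0 z; have lw : (ell w)^* != 0 by rewrite conjC_eq0 ell_neq0.
have p0 := kP_neq0 z w; have := kP_evn z w.
have [_ /(_ z w)] := horo_psd (lexx 0) evn_lt1; rewrite mul0r addr0.
move: (1 - evn z * _) => e e0 he.
have -> : kP z w = ell z * (ell w)^* * e / (1 - a) by rewrite -he mulrC mulKf.
by field; rewrite e0 lz lw am0.
Qed.

Lemma kG_neq0 z w : kG z w != 0.
Proof.
have := kXG_tau z w => e; apply/eqP => g0.
move: e; rewrite g0 mulr0 => /esym/eqP.
by rewrite mulf_eq0 expf_eq0 /= (negbTE (kP_neq0 z w)) (negbTE (tau2_neq1 z w)).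
Qed.

Lemma psd_kEven : psd kEven.
Proof.
apply: eq_psd (psdM psd_kPV (psd_geom psd_tau2 tau2_diag)) => z w.
rewrite /kEven /kOdd kXG_tau; have := tau2_neq1 z w; have := kP_neq0 z w.
by move: (kP z w) (1 - _) => p t p0 t1; field; rewrite p0 t1.
Qed.

Lemma kOddE z w : kOdd z w = (kP z w)^-1 * kEven z w.
Proof. by rewrite /kEven mulrA mulVf ?mul1r // kP_neq0. Qed.

Lemma psd_kOdd : psd kOdd.
Proof.
by apply: eq_psd (psdM psd_kPV psd_kEven) => z w; rewrite kOddE.
Qed.

End ParityKernels.

(** * Comparison of the even and odd parts with the Szego and model kernels *)

Section ParityEstimates.
Variables (R : realType) (T : Type).
Local Notation C := R[i].
Variables (zt : T -> C) (a : C).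
Hypotheses (a0 : 0 < a) (a1 : a < 1).
Hypothesis zt1 : forall z, `|zt z| < 1.
Hypothesis evn_sqo : forall z, `|evn zt a z| ^+ 2 + `|sqo zt a z| < 1.

Local Notation X := (kX zt).
Local Notation Pi := (kPi zt).
Local Notation Th := (kTh zt a).
Local Notation th := (theta zt a).
Local Notation M := (kM zt a).
Local Notation P := (kP zt a).
Local Notation G := (kG zt a).
Local Notation Odd := (kOdd zt a).
Local Notation Even := (kEven zt a).
Local Notation q := (qa a).

Let ac : a^* = a. Proof. exact/conj_ge0_id/ltW. Qed.
Let ap : 0 < 1 + a. Proof. by rewrite addr_gt0. Qed.
Let am : 0 < 1 - a. Proof. by rewrite subr_gt0. Qed.
Let ap0 : 1 + a != 0. Proof. by rewrite gt_eqF. Qed.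
Let am0 : 1 - a != 0. Proof. by rewrite gt_eqF. Qed.
Let an0 : a != 0. Proof. by rewrite gt_eqF. Qed.
Let qp : 0 < q. Proof. by rewrite !mulr_gt0. Qed.
Let q0 : q != 0. Proof. by rewrite gt_eqF. Qed.

Let x0 z w : X z w != 0. Proof. exact: kX_neq0. Qed.
Let g0 z w : X z w * M z w ^+ 2 + 2 * (q * Pi z w) * M z w + (q * Pi z w) ^+ 2 != 0.
Proof. exact: kG_neq0. Qed.
Let t0 c z w : 0 < c -> X z w + c * Pi z w != 0.
Proof. by move=> /ltW c0; apply: kT_denom_neq0. Qed.
Let th0 z : th z != 0. Proof. exact: theta_neq0. Qed.
Let thc0 w : (th w)^* != 0. Proof. by rewrite conjC_eq0. Qed.
Let pXV : psd (fun z w => (X z w)^-1). Proof. exact: psd_kXV. Qed.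
Let pPi : psd Pi. Proof. exact: psd_kPi. Qed.
Let pTh : psd Th. Proof. exact: psd_kTh. Qed.
Let pM : psd M. Proof. exact: psd_kM. Qed.
Let pT c : 0 < c -> psd (kT zt c). Proof. by move=> /ltW; apply: psd_kT. Qed.
Let pOdd : psd Odd. Proof. exact: psd_kOdd. Qed.
Let pEven : psd Even. Proof. exact: psd_kEven. Qed.
Let px : psd (fun z w => zt z * (zt w)^*). Proof. exact: psd_rank1. Qed.
Let xE z w : zt z * (zt w)^* = 1 - X z w. Proof. by rewrite /kX; ring. Qed.

(** Since [M P + q Pi (M + q Pi) = G] and [G Odd = 1 / X], the kernel [M Even] lies below [1 / X];
    then [1 <= c M] is used. *)
Lemma dom_kEven_Szego : dom Even (fun z w => (X z w)^-1).
Proof.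
have [c c0 h] := dom_1_kM zt a0 a1; exists c => //.
have pQ := psdZ (ltW qp) pPi.
have p2 := psdZ c0 (psdM (psdM pQ (psdD pM pQ)) pOdd).
apply: eq_psd (psdD (psdM pEven h) p2) => z w.
by rewrite /kEven /kOdd /kP /kG; field; rewrite g0 x0.
Qed.

(** Both constants are compared with the larger [c + c'], where each difference is an explicit
    product of positive kernels. *)
Lemma dom_kModel c c' : 0 < c -> 0 < c' -> dom (kModel zt c) (kModel zt c').
Proof.
move=> c0 c1; have cc : 0 < c + c' by rewrite addr_gt0.
apply: (@dom_trans _ _ (kModel zt (c + c'))).
  exists ((c + c') / c); first by rewrite divr_ge0 // ltW.
  have d0 : 0 <= c' / c by rewrite divr_ge0 // ltW.
  apply: eq_psd (psdZ d0 (psdM (pT c0) (pT cc))) => z w.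
  by rewrite /kModel /kT; field; rewrite x0 !t0 //= gt_eqF.
apply: psd_dom.
have p := psdM (psdM pPi pXV) (psdM (pT c1) (pT cc)).
apply: eq_psd (psdZ (ltW c0) p) => z w.
by rewrite /kModel /kT; field; rewrite x0 !t0.
Qed.

(** On the disc, these two bounds are obtained from multipliers of the full kernel by
    [bounded_kEven]. *)
Hypothesis bz : bounded_mul Even zt.
Hypothesis bt : bounded_mul Even (fun z => (th z)^-1).

Lemma dom_kEven_kOdd B : dom (fun z w => B z w * Even z w) Even ->
  dom (fun z w => B z w * Odd z w) Odd.
Proof.
move=> h; have pV := psd_kPV a0 a1 zt1 evn_sqo.
apply: eq_dom (domM pV h) => z w; rewrite (kOddE a0 a1) //.
by rewrite mulrCA.
Qed.

Let b1z : bounded_mul Even (fun z => 1 - zt z).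
Proof.
apply: eq_bounded_mul (bounded_mulD pEven (bounded_mul_cst _ 1)
  (bounded_mulZ (-1) bz)) => z.
by rewrite mulN1r.
Qed.

Let bth : bounded_mul Even th.
Proof.
exact: eq_bounded_mul (bounded_mulD pEven (bounded_mul_cst _ 1)
  (bounded_mulZ a bz)).
Qed.

Let dPi : dom (fun z w => Pi z w * Even z w) Even. Proof. exact: b1z. Qed.
Let dTh : dom (fun z w => Th z w * Even z w) Even. Proof. exact: bth. Qed.

Let dM : dom (fun z w => M z w * Even z w) Even.
Proof.
have h1 : 0 <= (1 - a) ^+ 2 / (1 + a) by rewrite divr_ge0 ?exprn_ge0 // ltW.
have h2 : 0 <= 4 * a ^+ 3 / (1 + a).
  by rewrite divr_ge0 ?mulr_ge0 ?exprn_ge0 // ltW.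
apply: eq_dom (domD (domZ h1 dTh) (domZ h2 dPi)) => z w //.
by rewrite /kM; ring.
Qed.

Let dM2 : dom (fun z w => M z w ^+ 2 * Even z w) Even.
Proof.
apply: dom_trans dM; apply: eq_dom (domM pM dM) => z w //.
by ring.
Qed.

Lemma dom_kOdd_kModel_small : exists2 c, 0 < c & dom Odd (kModel zt c).
Proof.
have [C1 C10 h1] := dom_gt0 pM (dom_1_kM zt a0 a1).
have [C2 C20 h2] := dom_gt0 pOdd (dom_kEven_kOdd dM2).
(* Dividing [G] by [X + c Pi] gives [M^2] plus [Pi (2 q M + q^2 Pi - c M^2) / (X + c Pi)]. The
   choice [c C2 = 2 q / C1] lets [2 q M] absorb [c M^2] after multiplication by [Odd]. *)
have c0 : 0 < 2 * q / (C1 * C2) by rewrite divr_gt0 ?mulr_gt0.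
exists (2 * q / (C1 * C2)) => //; exists (C1 ^+ 2); first by rewrite exprn_ge0 // ltW.
have C1n : C1 != 0 by rewrite gt_eqF.
have cn : 2 * q / (C1 * C2) != 0 by rewrite gt_eqF.
have e2 : C2 = 2 * q / (2 * q / (C1 * C2) * C1).
  by field; rewrite q0 C1n gt_eqF.
have pt := pT c0.
move: (2 * q / (C1 * C2)) e2 c0 cn pt h2 => c -> c0 cn pt h2.
have hq : 0 <= 2 * q / C1 by rewrite divr_ge0 ?mulr_ge0 // ltW.
have hq2 : 0 <= q ^+ 2 by rewrite exprn_ge0 // ltW.
have hC : 0 <= C1 ^+ 2 by rewrite exprn_ge0 // ltW.
have pM1 := psdD (psdZ (ltW C10) pM) (@psd1 R T).
have p1 := psdM pOdd (psdM h1 pM1).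
have p2 := psdD (psdD (psdZ hq (psdM h1 pOdd)) (psdZ (ltW c0) h2))
  (psdZ hq2 (psdM pPi pOdd)).
apply: eq_psd (psdD p1 (psdZ hC (psdM (psdM pt pPi) p2))) => z w.
by rewrite /kModel /kT /kOdd /kG; field; rewrite x0 t0 // g0 C1n cn.
Qed.

Lemma dom_kOdd_kModel c : 0 < c -> dom Odd (kModel zt c).
Proof.
move=> c0; have [d d0 h] := dom_kOdd_kModel_small.
exact: dom_trans h (dom_kModel d0 c0).
Qed.

Let hh z := 2 * a / (1 - a) ^+ 2 * (2 / th z - 1).

(* The half-plane form of [evn], namely [P / Th], differs from that of [zt],
   namely [X / Pi], by the real part of the bounded function [hh]. *)
Let P_hh z w : (1 + a) / (1 - a) ^+ 2 * P z w =
  Th z w * (X z w + Pi z w * (hh z + (hh w)^*)).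
Proof.
have -> : (hh w)^* = 2 * a / (1 - a) ^+ 2 * (2 / (th w)^* - 1).
  rewrite /hh !(rmorphM, rmorphB, rmorphXn, rmorph1, fmorphV, rmorph_nat) /=.
  by rewrite ac.
have -> : Th z w * (X z w + Pi z w * (hh z + 2 * a / (1 - a) ^+ 2 * (2 / (th w)^* - 1)))
  = Th z w * X z w + Pi z w * (2 * a / (1 - a) ^+ 2 *
      (2 * (th w)^* + 2 * th z - 2 * (th z * (th w)^*))).
  by rewrite /hh /kTh; field; rewrite th0 thc0 am0.
rewrite /kP /kM /qa /kTh theta_conj // kPiE /theta /kX.
by field; rewrite ap0 am0.
Qed.

Lemma dom_kModel_kOdd c : 0 < c -> dom (kModel zt c) Odd.
Proof.
move=> c0.
have hq2 : 0 <= q ^+ 2 by rewrite exprn_ge0 // ltW.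
have hq : 0 <= 2 * q by rewrite mulr_ge0 // ltW.
have [B B0 hB] := dom_gt0 pEven (domD dM2 (domD (domZ hq dM) (domZ hq2 dPi))).
have pMPi := psdD (psdZ hq pM) (psdZ hq2 pPi).
have hBM : psd (fun z w => B * Even z w - M z w ^+ 2 * Even z w).
  by apply: eq_psd (psdD hB (psdM pMPi pEven)) => z w; ring.
have pV := psd_kPV a0 a1 zt1 evn_sqo.
have oE z w := kOddE a0 a1 zt1 evn_sqo z w.
have hBMo : psd (fun z w => B * Odd z w - M z w ^+ 2 * Odd z w).
  by apply: eq_psd (psdM pV hBM) => z w; rewrite oE; ring.
have hBo : psd (fun z w => B * Odd z w -
    (M z w ^+ 2 + 2 * q * M z w + q ^+ 2 * Pi z w) * Odd z w).
  by apply: eq_psd (psdM pV hB) => z w; rewrite oE; ring.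
have bh : bounded_mul Even hh.
  exact: bounded_mulZ (bounded_mulD pEven (bounded_mulZ 2 bt)
    (bounded_mul_cst _ (-1))).
have bho := dom_kEven_kOdd bh.
have [C1 C10 h1] := dom_gt0 pOdd bho.
(* By [P_hh], positivity of [(2 B - M^2) Even] controls [X] only together with the cross terms of
   [hh]. The kernel [pb] completes them to a square, and [2 C1] pays for [hh hh^*]:
   [pa + Pi (pb + pc)] is [(X + eta Pi) (2 B - M^2) Odd]. *)
pose eta := 1 + 2 * C1; have eta0 : 0 < eta by rewrite addr_gt0 ?mulr_gt0.
have e1 : 0 < eta + 1 by rewrite addr_gt0.
apply: dom_trans (dom_kModel c0 e1) _.
exists (2 * B); first by rewrite mulr_ge0 // ltW.
pose a2 := (1 + a) / (1 - a) ^+ 2.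
have a20 : 0 <= a2 by rewrite divr_ge0 ?exprn_ge0 // ltW.
have pa : psd (fun z w => (X z w + Pi z w * (hh z + (hh w)^*)) *
    (2 * B - M z w ^+ 2) * Odd z w).
  have p := psdZ a20 (psd_congr (fun z => (th z)^-1)
    (psdD (psdZ (ltW B0) pEven) hBM)).
  apply: eq_psd p => z w; rewrite fmorphV /kEven.
  have -> : P z w = a2^-1 * (Th z w * (X z w + Pi z w * (hh z + (hh w)^*))).
    by rewrite -P_hh mulKf // mulf_neq0 ?invr_eq0 ?expf_neq0.
  rewrite /kTh; move: (hh z + _) (Odd z w) => y o.
  by field; rewrite thc0 th0 mulf_neq0 ?invr_eq0 ?expf_neq0.
have pb : psd (fun z w => (1 - hh z) * (1 - hh w)^* *
    ((2 * B - M z w ^+ 2) * Odd z w)).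
  apply: psd_congr; apply: eq_psd (psdD (psdZ (ltW B0) pOdd) hBMo) => z w.
  by ring.
have C12 : 0 <= 2 * C1 by rewrite mulr_ge0 // ltW.
have B2 : 0 <= 2 * B by rewrite mulr_ge0 // ltW.
have pc := psdD (psdD (psdZ C12 hBMo) (psdZ B2 h1))
  (psd_congr hh (psdM (psdX 2 pM) pOdd)).
(* The additional [1] in [eta + 1] pays for [G - X M^2 = Pi (2 q M + q^2 Pi)]; the total becomes
   [2 B (X + (eta + 1) Pi) Odd - G Odd]. *)
have pd := psdD (psdD (psdZ (ltW B0) pOdd) hBo)
  (psdZ (ltW eta0) (psdM (psdX 2 pM) pOdd)).
have pMo := psdM (psdX 2 pM) pOdd.
have p := psdD (psdD pa (psdM pPi (psdD pb pc))) (psdM pPi (psdD pd pMo)).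
apply: eq_psd (psdM (pT e1) p) => z w.
rewrite rmorphB rmorph1 /kModel /kT /kOdd /kG /=.
move: (hh z) ((hh w)^*) => y y'; have := t0 z w e1; rewrite /eta.
by move=> tt0; field; rewrite x0 g0 tt0.
Qed.

Let ThE z w : Th z w = ((1 + a) * M z w - 4 * a ^+ 3 * Pi z w) / (1 - a) ^+ 2.
Proof. by rewrite /kM; field; rewrite ap0 am0. Qed.

Let dom_Th : exists2 d, 0 < d & psd (fun z w => d * (Th z w * Even z w) - Even z w).
Proof.
have [d d0 h] := dom_gt0 pEven bt; exists d => //.
apply: eq_psd (psdM pTh h) => z w; rewrite /kTh fmorphV /=; move: (Even z w) => y.
by field; rewrite th0 thc0.
Qed.

Lemma dom_kT_kEven : exists2 c, 0 < c & dom (kT zt c) Even.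
Proof.
have [d d0 hd] := dom_Th.
have [C1 C10 h1] := dom_gt0 pEven dTh.
(* With [c (1 - a)^2 = 4 a d] the terms in [Pi Th] cancel, and what remains is
   [P Even - (q Pi)^2 zt zt^* Odd = 1], which is [kPG] multiplied by [Odd]. *)
have c0 : 0 < 4 * a * d / (1 - a) ^+ 2 by rewrite divr_gt0 ?mulr_gt0 ?exprn_gt0.
exists (4 * a * d / (1 - a) ^+ 2) => //.
have A0 : 0 <= (1 - a) ^+ 2 / (1 + a) by rewrite divr_ge0 ?exprn_ge0 // ltW.
exists ((1 - a) ^+ 2 / (1 + a) * C1); first by rewrite mulr_ge0 // ltW.
have dE : d = 4 * a * d / (1 - a) ^+ 2 * (1 - a) ^+ 2 / (4 * a).
  by field; rewrite an0 am0.
have pt := pT c0; have tn z w := t0 z w c0.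
move: (4 * a * d / _) dE pt tn => c dE pt tn; rewrite dE in hd.
have a4 : 0 <= 4 * a / (1 + a) by rewrite divr_ge0 ?mulr_ge0 // ltW.
have a42 : 0 <= 4 * a ^+ 3 / (1 + a) by rewrite divr_ge0 ?mulr_ge0 ?exprn_ge0 // ltW.
have p1 := psdD (psdZ a4 hd) (psdZ a42 (psdM px pEven)).
have p2 := psdM (psdX 2 (psdZ (ltW qp) pPi)) (psdM px pOdd).
apply: eq_psd (psdD (psdD (psdZ A0 h1) (psdM (psdM pt pPi) p1)) (psdM pt p2)) => z w.
rewrite xE ThE /kEven /kOdd /kP /kG /kT; have := g0 z w; rewrite /qa => gg.
by field; rewrite x0 tn gg ap0 an0 am0.
Qed.

Let bell : bounded_mul Even (ell zt a).
Proof.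
apply: (bounded_mulX 2); apply: eq_bounded_mul (bounded_mulD pEven
  (bounded_mul_cst _ 1) (bounded_mulZ (- a) bz)) => z.
by rewrite mulNr.
Qed.

(** By [kP_evn] the difference is a multiple of [ell ell^* evn evn^* Even], because
    [P Even = 1 + (q Pi)^2 zt zt^* Odd]. Dropping either of the two subtracted terms gives one of
    the next two dominations. *)
Let pell : psd (fun z w => (1 - a)^-1 * (ell zt a z * (ell zt a w)^* * Even z w)
  - ((q * Pi z w) ^+ 2 * (zt z * (zt w)^*) * Odd z w + 1)).
Proof.
have am1 : 0 <= (1 - a)^-1 by rewrite invr_ge0 ltW.
have p := psd_congr (ell zt a) (psd_congr (evn zt a) pEven).
apply: eq_psd (psdZ am1 p) => z w.
have -> : ell zt a z * (ell zt a w)^* * (evn zt a z * (evn zt a w)^* * Even z w) =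
  (ell zt a z * (ell zt a w)^* - (1 - a) * P z w) * Even z w.
  by rewrite (kP_evn a0 a1 zt1); ring.
move: (ell zt a z * _) => l.
rewrite xE /kEven /kOdd /kP /kG; field.
by rewrite x0 g0 am0.
Qed.

Lemma dom_1_kEven : dom (fun _ _ => 1) Even.
Proof.
have am1 : 0 <= (1 - a)^-1 by rewrite invr_ge0 ltW.
apply: (dom_trans _ (domZ am1 bell)); apply: psd_dom.
have p := psdM (psdX 2 (psdZ (ltW qp) pPi)) (psdM px pOdd).
by apply: eq_psd (psdD pell p) => z w; ring.
Qed.

Let dom_Pi2x_kOdd :
  dom (fun z w => Pi z w ^+ 2 * (zt z * (zt w)^*) * Odd z w) Even.
Proof.
have am1 : 0 <= (1 - a)^-1 by rewrite invr_ge0 ltW.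
apply: (dom_trans _ (domZ am1 bell)).
exists (q ^+ 2)^-1; first by rewrite invr_ge0 exprn_ge0 // ltW.
have qq : 0 <= (q ^+ 2)^-1 by rewrite invr_ge0 exprn_ge0 // ltW.
apply: eq_psd (psdZ qq (psdD pell (@psd1 R T))) => z w.
by field; rewrite q0 am0.
Qed.

Let dom_Pi_kEven B : psd B -> dom B Even -> dom (fun z w => Pi z w * B z w) Even.
Proof. by move=> pB h; apply: dom_trans (domM pPi h) dPi. Qed.

(** Multiplying [1 / X = kT c + c Pi kModel c] by the positive kernel [Pi zt zt^* = Pi (1 - X)]
    writes [Pi / X - Pi] in terms already dominated by [Even]. *)
Lemma dom_PiSzego_kEven : dom (fun z w => Pi z w / X z w) Even.
Proof.
have [c c0 hT] := dom_kT_kEven; have d1 := dom_kModel_kOdd c0.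
have p2 : psd (fun z w => Pi z w ^+ 2 * (zt z * (zt w)^*)) := psdM (psdX 2 pPi) px.
have d2 := dom_trans (domM p2 d1) dom_Pi2x_kOdd.
have d3 := dom_Pi_kEven (pT c0) hT.
have d4 : dom (fun z w => zt z * (zt w)^* * (Pi z w * kT zt c z w)) Even.
  by apply: dom_trans (domM px d3) bz.
have d5 := dom_Pi_kEven (@psd1 R T) dom_1_kEven.
apply: eq_dom (domD (domD (domZ (ltW c0) d2) d4) d5) => z w //.
by rewrite xE /kModel /kT; field; rewrite x0 t0.
Qed.

Lemma dom_Pi2_kOdd_kEven : dom (fun z w => Pi z w ^+ 2 * Odd z w) Even.
Proof.
have d := domM (psdX 2 pPi) (dom_kOdd_kModel ltr01).
apply: dom_trans d _; apply: dom_trans dom_PiSzego_kEven; apply: psd_dom.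
apply: eq_psd (psdM pPi (pT ltr01)) => z w.
have := t0 z w ltr01; rewrite /kModel /kT mul1r => t1.
by field; rewrite x0 t1.
Qed.

(** The value makes [dlt^2 (1 + a)^4 = q^2 / 4], so the leading term of [dlt^2 Th^2] in [pth2] is
    only half of [q^2 zt zt^*]. *)
Let dlt := q / (2 * (1 + a) ^+ 2).
Let dlt0 : 0 < dlt. Proof. by rewrite divr_gt0 ?mulr_gt0 ?exprn_gt0. Qed.

(** A half-plane kernel in the sense of [horo_psd], for [evn]: by [evn1B], [Pi Th] is a rank-one
    multiple of [(1 - evn) (1 - evn)^*]. *)
Let kR z w := (P z w + dlt * (Pi z w * Th z w))^-1.

Let kR_spec : psd kR /\ forall z w, P z w + dlt * (Pi z w * Th z w) != 0.
Proof.
have k0 : 0 <= dlt / (1 - a) by rewrite divr_ge0 // ltW.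
have [h h0] := horo_psd k0 (evn_lt1 evn_sqo).
have lz z := ell_neq0 a0 a1 zt1 z.
have lw w : (ell zt a w)^* != 0 by rewrite conjC_eq0.
have e z w : P z w + dlt * (Pi z w * Th z w) =
    ell zt a z * (ell zt a w)^* / (1 - a) *
    (1 - evn zt a z * (evn zt a w)^* +
       dlt / (1 - a) * ((1 - evn zt a z) * (1 - evn zt a w)^*)).
  have -> : P z w = (1 - a)^-1 *
      (ell zt a z * (ell zt a w)^* * (1 - evn zt a z * (evn zt a w)^*)).
    by rewrite -kP_evn // mulKf.
  have -> : (1 - evn zt a w)^* =
      (1 - a) * (1 - zt w)^* * (th w)^* / (ell zt a w)^*.
    by rewrite evn1B // fmorph_div 2!rmorphM /= [(1 - a)^*]rmorphB rmorph1 /= ac.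
  rewrite evn1B // /kTh /kPi; move: (evn zt a z * _) => ee.
  by field; rewrite lz lw am0.
split=> [|z w]; last first.
  rewrite e; apply: mulf_neq0 (h0 z w); apply: mulf_neq0; last by rewrite invr_eq0.
  exact: mulf_neq0.
have p := psdZ (ltW am) (psd_congr (fun z => (ell zt a z)^-1) h).
apply: eq_psd p => z w; rewrite /kR e fmorphV /=.
have := h0 z w; move: (1 - _ + _) => y y0.
by field; rewrite y0 lz lw am0.
Qed.

Let b_ z := 1 - a ^+ 2 * zt z.

Let bb : bounded_mul Even b_.
Proof.
apply: eq_bounded_mul (bounded_mulD pEven (bounded_mul_cst _ 1)
  (bounded_mulZ (- a ^+ 2) bz)) => z.
by rewrite mulNr.
Qed.

(* [theta^2 = (1 + a)^2 zt + (1 - zt) b_] *)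
Let pth2 : psd (fun z w => 2 * (1 + a) ^+ 4 * (zt z * (zt w)^*) +
  2 * (Pi z w * (b_ z * (b_ w)^*)) - Th z w ^+ 2).
Proof.
apply: eq_psd (psd_rank1 (fun z => (1 + a) ^+ 2 * zt z - (1 - zt z) * b_ z)) => z w.
rewrite /b_ kPiE /kTh theta_conj // /theta.
rewrite !(rmorphB, rmorphD, rmorphM, rmorphXn, rmorph1) /= ac.
by ring.
Qed.

(** Since [P Odd = Even], the product [(P + dlt Pi Th) (Even - dlt Th Pi Odd)] equals
    [1 + Pi^2 (q^2 zt zt^* - dlt^2 Th^2) Odd]. By [pth2] the bracket is positive up to a multiple of
    [Pi], and adding [K Pi^2 Odd] to [Even] compensates for it. Dividing by [P + dlt Pi Th] means
    multiplying by the positive [kR]. *)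
Lemma dom_Pi_kOdd_kEven : dom (fun z w => Pi z w * Odd z w) Even.
Proof.
have [d d0 hd] := dom_Th; have [e e0 he] := dom_gt0 pEven bb.
have pV := psd_kPV a0 a1 zt1 evn_sqo.
have oE z w := kOddE a0 a1 zt1 evn_sqo z w.
have hdo : psd (fun z w => d * (Th z w * Odd z w) - Odd z w).
  by apply: eq_psd (psdM pV hd) => z w; rewrite oE; ring.
have heo : psd (fun z w => e * Odd z w - b_ z * (b_ w)^* * Odd z w).
  by apply: eq_psd (psdM pV he) => z w; rewrite oE; ring.
pose K := 2 * dlt * (e * d); have K0 : 0 < K.
  by apply: mulr_gt0 (mulr_gt0 e0 d0); apply: mulr_gt0 dlt0; rewrite ltr0n.
have [pR R0] := kR_spec.
have d20 : 0 <= 2 * dlt ^+ 2 by rewrite mulr_ge0 ?exprn_ge0 // ltW.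
have d21 : 0 <= dlt ^+ 2 by rewrite exprn_ge0 // ltW.
have q20 : 0 <= q ^+ 2 / 2 by rewrite divr_ge0 ?exprn_ge0 // ltW.
have p1 := psdZ d20 (psdM pPi (psdD (psdZ (ltW e0) hdo) heo)).
have p2 := psdD (psdZ d21 (psdM pth2 pOdd)) (psdZ q20 (psdM px pOdd)).
have p3 := psdM (psdM pR (psdX 2 pPi)) (psdD (psdZ (ltW K0) pEven) (psdD p1 p2)).
have key : psd (fun z w => (Even z w + K * (Pi z w ^+ 2 * Odd z w)) -
    dlt * (Th z w * (Pi z w * Odd z w))).
  apply: eq_psd (psdD pR p3) => z w.
  rewrite xE; move: (b_ z * _) => B.
  have eq4 : (1 + a) ^+ 4 = q ^+ 2 / (4 * dlt ^+ 2).
    by rewrite /dlt; field; rewrite q0 ap0.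
  have dn : dlt != 0 by rewrite gt_eqF.
  rewrite eq4 /K /kR /kEven /kOdd /kG; have := R0 z w; rewrite /kP.
  move: (dlt) dn (Th z w) => D D0 t r0.
  by field; rewrite x0 g0 r0 D0.
have dE : dom (fun z w => Even z w + K * (Pi z w ^+ 2 * Odd z w)) Even.
  by apply: domD (dom_refl _) (domZ (ltW K0) dom_Pi2_kOdd_kEven).
apply: dom_trans dE; apply: dom_trans (_ : dom _ (fun z w =>
  dlt * (Th z w * (Pi z w * Odd z w)))) (psd_dom key).
apply: domZr dlt0 _; exists d; first exact: ltW.
by apply: eq_psd (psdM pPi hdo) => z w; ring.
Qed.

(** Partial fractions: [1 / X = kT c + c Pi kModel c]. *)
Lemma dom_Szego_kEven : dom (fun z w => (X z w)^-1) Even.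
Proof.
have [c c0 hT] := dom_kT_kEven.
have d := dom_trans (domM pPi (dom_kModel_kOdd c0)) dom_Pi_kOdd_kEven.
apply: eq_dom (domD hT (domZ (ltW c0) d)) => z w //.
by rewrite /kModel /kT; field; rewrite x0 t0.
Qed.

End ParityEstimates.

(** * The kernel on the disc *)

Lemma mul_central_binomial n :
  (n.+1 * 'C(2 * n.+1, n.+1) = 2 * ((2 * n + 1) * 'C(2 * n, n)))%N.
Proof.
have f n0 : ('C(2 * n0, n0) * (n0`! * n0`!) = (2 * n0)`!)%N.
  by rewrite -[in RHS](@bin_fact (2 * n0) n0) ?leq_pmull // mul2n -addnn addnK.
have fn : (0 < n`! * n`!)%N by rewrite muln_gt0 fact_gt0.
apply/eqP; rewrite -(eqn_pmul2r fn) -(eqn_pmul2r (ltn0Sn n)); apply/eqP.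
have E : (2 * n.+1 = (2 * n).+2)%N by rewrite mulnS.
have e1 := f n.+1; rewrite E !factS -(f n) in e1; rewrite E.
transitivity ('C((2 * n).+2, n.+1) * (n.+1 * n`! * (n.+1 * n`!)))%N; first by ring.
by rewrite e1; ring.
Qed.

(** From [n] to [n + 1] the right side is multiplied by [2 (2 n + 3) / (n + 1)], which is at least
    [4]. *)
Lemma central_binomial_ge n : (4 ^ n <= (2 * n + 1) * 'C(2 * n, n))%N.
Proof.
elim: n => [|n IH] //; rewrite -(leq_pmul2l (ltn0Sn n)) expnS.
rewrite [X in (_ <= X)%N]mulnCA mul_central_binomial; nia.
Qed.

Section Rkhs.
Variable R : realType.
Local Notation C := R[i].
Implicit Types (k : Disc R -> Disc R -> C) (f g : Disc R -> C).

Lemma eq_in_rkhs k k' f f' : (forall z w, k z w = k' z w) ->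
  (forall z, f z = f' z) -> in_rkhs k f -> in_rkhs k' f'.
Proof.
move=> ek ef; have -> : k = k' by apply/funext => z; apply/funext => w.
by have -> : f = f' by apply/funext.
Qed.

Lemma in_rkhs_dom k k' f : psd k -> dom k k' -> in_rkhs k f -> in_rkhs k' f.
Proof.
(* The given [c] may be negative; replacing it by its absolute value keeps the bound and allows
   multiplication of the domination. *)
move=> pk [d d0 h] [c hc]; exists (`|c| * complex.Re d) => n z a.
have dE : d = (complex.Re d)%:C%C.
  by move: d0; rewrite lecE /= => /andP[/eqP d0 _]; rewrite [LHS]complexE d0 mulr0 addr0.
apply: le_trans (hc n z a) _; rewrite rmorphM /= -dE -mulrA.
apply: le_trans (_ : `|c|%:C%C * \sum_(i < n) \sum_(j < n)
    (a i)^* * a j * k (z j) (z i) <= _).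
  by apply: ler_wpM2r; [apply: pk | rewrite lecR ler_norm].
apply: ler_wpM2l; first by rewrite ler0c.
have := h n z a; rewrite -subr_ge0; congr (_ <= _).
rewrite mulr_sumr -sumrB; apply: eq_bigr => i _.
by rewrite mulr_sumr -sumrB; apply: eq_bigr => j _; ring.
Qed.

Lemma in_rkhs_scale k f g : in_rkhs k f ->
  in_rkhs (fun z w => g z * (g w)^* * k z w) (fun z => g z * f z).
Proof.
move=> [c h]; exists c => n z a.
have := h n z (fun i => a i * g (z i)); congr (_ <= _).
  by congr (`|_| ^+ 2); apply: eq_bigr => i _; rewrite mulrA.
congr (_ * _); apply: eq_bigr => i _; apply: eq_bigr => j _.
by rewrite rmorphM /=; ring.
Qed.

End Rkhs.

(** * The kernel of [frr r] and its multipliers *)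

Section DiscKernel.
Variables (R : realType) (r : R).
Local Notation C := R[i].
Implicit Types z w y : Disc R.
Hypotheses (rn0 : r != 0) (r1 : `|r| < 1).

Let rc : C := r%:C%C.
Let a : C := rc ^+ 2.
Definition disc_sq (z : Disc R) : C := val z ^+ 2.
Local Notation zt := disc_sq.

Let rcc : rc^* = rc. Proof. exact: conjc_real. Qed.
Let nrc : `|rc| < 1.
Proof.
by rewrite normc_def /= expr0n addr0 sqrtr_sqr -(rmorph1 (real_complex R)) ltcR.
Qed.
Let aE : a = (r ^+ 2)%:C%C. Proof. by rewrite /a rmorphXn. Qed.
Let a0 : 0 < a.
Proof. by rewrite aE -[0]/(0%:C%C) ltcR lt_def sqrf_eq0 rn0 sqr_ge0. Qed.
Let a1 : a < 1.
Proof.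
rewrite aE -(rmorph1 (real_complex R)) ltcR -(ger0_norm (sqr_ge0 r)) normrX.
by rewrite exprn_ilt1.
Qed.
Let an0 : a != 0. Proof. by rewrite gt_eqF. Qed.
Let am0 : 1 - a != 0. Proof. by rewrite gt_eqF // subr_gt0. Qed.
Let ap0 : 1 + a != 0. Proof. by rewrite gt_eqF // addr_gt0. Qed.

Lemma norm_disc (z : Disc R) : `|val z| < 1.
Proof. exact: valP z. Qed.

Lemma norm_disc_sq z : `|zt z| < 1.
Proof. by rewrite /zt normrX exprn_ilt1 // norm_disc. Qed.
Local Notation zt1 := norm_disc_sq.

Let mz z : 1 - rc * val z != 0.
Proof. by rewrite sub1_neq0 // normrM mulr_ilt1 // norm_disc. Qed.
Let pz z : 1 + rc * val z != 0.
Proof.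
have := @sub1_neq0 R (- (rc * val z)); rewrite opprK normrN; apply.
by rewrite normrM mulr_ilt1 // norm_disc.
Qed.

Lemma norm_blaschke (s : R) (z : Disc R) : `|s| < 1 -> `|blaschke s (val z)| < 1.
Proof.
move=> s1; have ns : `|s%:C%C| < 1 :> C.
  by rewrite normc_def /= expr0n addr0 sqrtr_sqr -(rmorph1 (real_complex R)) ltcR.
have n0 : 1 - s%:C%C * val z != 0 :> C.
  by rewrite sub1_neq0 // normrM mulr_ilt1 // norm_disc.
rewrite /blaschke normf_div ltr_pdivrMr ?normr_gt0 // mul1r.
rewrite -(@ltr_pXn2r _ 2) ?nnegrE // -subr_gt0 !normCK.
have sc : (s%:C%C)^* = s%:C%C :> C by apply: conjc_real.
have -> : (1 - s%:C%C * val z) * (1 - s%:C%C * val z)^* -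
    (val z - s%:C%C) * (val z - s%:C%C)^* =
    (1 - s%:C%C * (s%:C%C)^*) * (1 - val z * (val z)^*).
  by rewrite !(rmorphB, rmorphM, rmorph1) /= sc; ring.
by rewrite -!normCK mulr_gt0 // subr_gt0 exprn_ilt1 // norm_disc.
Qed.

Let u z := blaschke r (val z) ^+ 2.
Let v z := blaschke (- r) (val z) ^+ 2.

Let u1 z : `|u z| < 1. Proof. by rewrite normrX exprn_ilt1 // norm_blaschke. Qed.
Let v1 z : `|v z| < 1.
Proof. by rewrite normrX exprn_ilt1 // norm_blaschke // normrN. Qed.

Let uE z : u z = ((val z - rc) / (1 - rc * val z)) ^+ 2. Proof. by []. Qed.
Let vE z : v z = ((val z + rc) / (1 + rc * val z)) ^+ 2.
Proof. by rewrite /v /blaschke rmorphN /= opprK mulNr opprK. Qed.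

Let maz z : 1 - a * zt z = (1 - rc * val z) * (1 + rc * val z).
Proof. by rewrite /a /zt; ring. Qed.

Let evnE z : evn zt a z = (u z + v z) / 2.
Proof.
rewrite /evn /ell maz uE vE /zt /a.
by field; rewrite mz pz.
Qed.

Let d z := (u z - v z) / 2.

Let d_ell z : d z * ell zt a z = - 2 * rc * val z * (1 - a) * (1 - zt z).
Proof.
rewrite /d /ell maz uE vE /zt /a.
by have := mz z; have := pz z; move: (val z) => x p0 m0; field; rewrite p0 m0.
Qed.

Let sqoE z : sqo zt a z = d z ^+ 2.
Proof.
have l0 : ell zt a z != 0 by apply: ell_neq0 => //; apply: zt1.
have l2 := expf_neq0 2 l0; apply: (mulIf l2).
rewrite -exprMn d_ell /sqo (mulfVK l2).
by rewrite /a /zt; ring.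
Qed.

Let evn_sqo z : `|evn zt a z| ^+ 2 + `|sqo zt a z| < 1.
Proof.
rewrite sqoE normrX evnE /d !normCK; have := v1 z; have := u1 z.
move: (u z) (v z) => x y x1 y1.
have -> : (x + y) / 2 * ((x + y) / 2)^* + (x - y) / 2 * ((x - y) / 2)^*
   = (x * x^* + y * y^*) / 2.
  by rewrite !(rmorphM, rmorphB, rmorphD, fmorphV, rmorph_nat) /=; field.
rewrite -!normCK ltr_pdivrMr // mul1r -[2]/(1 + 1).
by apply: ltrD; rewrite exprn_ilt1.
Qed.

Let t (z w : Disc R) := val z * (val w)^*.

Definition disc_kernel z w : C := kEven zt a z w + t z w * (qa a * kPi zt z w * kOdd zt a z w).

Let L z w := (u z * (u w)^* + v z * (v w)^*) / 2.

Let L_P z w : ell zt a z * (ell zt a w)^* * (1 - L z w) =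
  (1 - a) * (kP zt a z w - t z w * (qa a * kPi zt z w)).
Proof.
rewrite [RHS]mulrBr (kP_evn a0 a1 zt1) !evnE.
have dE : d z * (d w)^* * (ell zt a z * (ell zt a w)^*) =
    (1 - a) * (t z w * (qa a * kPi zt z w)).
  have -> : d z * (d w)^* * (ell zt a z * (ell zt a w)^*) =
    (d z * ell zt a z) * (d w * ell zt a w)^*.
    by rewrite [(d w * _)^*]rmorphM /= mulrACA.
  rewrite !d_ell /t /kPi /qa /a /zt.
  rewrite !(rmorphM, rmorphB, rmorphN, rmorphXn, rmorph1, rmorph_nat) /= rcc.
  by move: (rc) (val z) ((val w)^*) => c x y; ring.
rewrite -dE /L /d; move: (u z) (v z) (u w) (v w) (ell _ _ _ * _) => x y x' y' l.
by rewrite !(rmorphM, rmorphB, rmorphD, fmorphV, rmorph_nat) /=; field.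
Qed.

Let pL : psd L.
Proof.
have h2 : 0 <= 2^-1 :> C by rewrite invr_ge0 ler0n.
apply: eq_psd (psdZ h2 (psdD (psd_rank1 u) (psd_rank1 v))) => z w.
by rewrite mulrC.
Qed.

Let L_diag z : L z z < 1.
Proof.
rewrite /L !mulc_conj ltr_pdivrMr // mul1r -[2]/(1 + 1).
by apply: ltrD; rewrite exprn_ilt1.
Qed.

Let L_neq1 z w : 1 - L z w != 0.
Proof. by apply: sub1_neq0; apply: psd_lt1. Qed.

Let K z w := (1 - L z w)^-1.
Let pK : psd K. Proof. exact: psd_geom. Qed.

Lemma kernel_of_frr z w : kernel_of (frr r) z w = (1 - L z w)^-1.
Proof.
rewrite /kernel_of /frr /= -/(u z) -/(v z) -/(u w) -/(v w); congr (_^-1).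
have s2 : ((Num.sqrt (2 : R))^-1)%:C%C * ((Num.sqrt (2 : R))^-1)%:C%C = 2^-1 :> C.
  by rewrite -rmorphM /= -invfM -expr2 sqr_sqrtr // fmorphV rmorph_nat.
have sc : (((Num.sqrt (2 : R))^-1)%:C%C)^* = ((Num.sqrt (2 : R))^-1)%:C%C :> C.
  exact: conjc_real.
move: (((Num.sqrt (2 : R))^-1)%:C%C) s2 sc => s s2 sc.
rewrite /L; move: (u z) (v z) (u w) (v w) => x y x' y'.
have -> : (s * x') ^* = s * x'^* by rewrite rmorphM /= sc.
have -> : (s * y') ^* = s * y'^* by rewrite rmorphM /= sc.
have -> : s * x * (s * x'^*) + s * y * (s * y'^*) = (s * s) * (x * x'^* + y * y'^*).
  by ring.
by rewrite s2 mulrC.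
Qed.

Let K_disc_kernel z w :
  K z w = (1 - a)^-1 * (ell zt a z * (ell zt a w)^*) * disc_kernel z w.
Proof.
have := L_P z w; have := L_neq1 z w.
have lz y : ell zt a y != 0 by apply: ell_neq0 => //; apply: zt1.
have lw : (ell zt a w)^* != 0 by rewrite conjC_eq0.
have x0 := kX_neq0 zt1 z w; have g0 := kG_neq0 a0 a1 zt1 evn_sqo z w.
have tE : t z w ^+ 2 = 1 - kX zt z w by rewrite /kX /t /zt rmorphXn /=; ring.
have e : (kP zt a z w - t z w * (qa a * kPi zt z w)) *
    (kP zt a z w + t z w * (qa a * kPi zt z w)) = kX zt z w * kG zt a z w.
  by rewrite -(kPG zt a z w) /disc_sq; rewrite -subr_sqr exprMn tE /kX /disc_sq; ring.
rewrite /disc_kernel /kEven /kOdd /K -e.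
have : kX zt z w * kG zt a z w != 0 by apply: mulf_neq0.
rewrite -e mulf_eq0 negb_or => /andP[].
have l0 : ell zt a z * (ell zt a w)^* != 0 by apply: mulf_neq0.
move: (ell zt a z * _) l0 (kP zt a z w) (qa a * _) (t z w) => l l0 P Q s m0 p0 n0.
move: (1 - L z w) n0 => n n0 eL.
have -> : n = (1 - a) * (P - s * Q) / l by rewrite -eL mulrC mulKf.
by field; rewrite p0 m0 l0 am0.
Qed.

Let two0 : 0 <= 2 :> C. Proof. by rewrite ler0n. Qed.

(** From [u u^* + v v^* = 2 L] and [(1 - L) K = 1], the kernel [2 K - u u^* K] is [2 + v v^* K]. *)
Let bu : bounded_mul K u.
Proof.
exists 2 => //; apply: eq_psd (psdD (psdZ two0 (@psd1 R _)) (psd_congr v pK)) => z w.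
have -> : u z * (u w)^* = 2 * (1 - (1 - L z w)) - v z * (v w)^*.
  by rewrite /L; field.
by rewrite /K; move: (1 - L z w) (L_neq1 z w) => n n0; field.
Qed.

Let bv : bounded_mul K v.
Proof.
exists 2 => //; apply: eq_psd (psdD (psdZ two0 (@psd1 R _)) (psd_congr u pK)) => z w.
have -> : v z * (v w)^* = 2 * (1 - (1 - L z w)) - u z * (u w)^*.
  by rewrite /L; field.
by rewrite /K; move: (1 - L z w) (L_neq1 z w) => n n0; field.
Qed.

Let beta z := (zt z - a) / (1 - a * zt z).

Let maz0 z : 1 - a * zt z != 0. Proof. by rewrite maz mulf_neq0. Qed.

Let betaE z : beta z = blaschke r (val z) * blaschke (- r) (val z).
Proof.
have -> : blaschke (- r) (val z) = (val z + rc) / (1 + rc * val z).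
  by rewrite /blaschke rmorphN /= opprK mulNr opprK.
have -> : blaschke r (val z) = (val z - rc) / (1 - rc * val z) by [].
rewrite /beta maz /a /zt.
by have := mz z; have := pz z; move: (val z) => x p0 m0; field; rewrite p0 m0.
Qed.

Let beta1 z : `|beta z| < 1.
Proof. by rewrite betaE normrM mulr_ilt1 ?norm_blaschke ?normrN. Qed.

Let beta2 z : u z * v z = beta z ^+ 2.
Proof. by rewrite betaE exprMn. Qed.

(** Over the denominator [ell], the functions [1], [beta], [evn] and [beta^2 = u v] are polynomials
    of degree at most two in [zt]; the resulting linear relation expresses [beta] by the others. *)
Let bbeta : bounded_mul K beta.
Proof.
have h1 := bounded_mulZ (- ((1 + a) / (1 - a)) ^+ 2)
  (bounded_mulD pK (bounded_mul_cst K 1) (bounded_mulZ (- 2^-1) (bounded_mulD pK bu bv))).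
have h2 := bounded_mulZ (2 * a / (1 - a) ^+ 2)
  (bounded_mulD pK (bounded_mul_cst K 1) (bounded_mulZ (-1) (bounded_mulM bu bv))).
apply: eq_bounded_mul
  (bounded_mulD pK (bounded_mul_cst K 1) (bounded_mulD pK h1 h2)) => z /=.
have -> : - 2^-1 * (u z + v z) = - evn zt a z by rewrite evnE; field.
rewrite beta2 /beta /evn /ell; have := maz0 z; move: (zt z) => x n0.
by field; rewrite n0 am0.
Qed.

(** A bound for the squared multiplier norm of [beta ^+ (2 * n)]. *)
Let cb n : R := 4 ^+ n / 'C(2 * n, n)%:R.

Let cb_le n : cb n <= (2 * n + 1)%:R.
Proof.
rewrite /cb ler_pdivrMr ?ltr0n ?bin_gt0 ?leq_pmull //.
by rewrite -natrM -natrX ler_nat central_binomial_ge.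
Qed.

(* The term of [L ^ (2 n) = ((|u|^2 + |v|^2) / 2) ^ (2 n)] carrying [(u v) ^ n]
   is ['C(2 n, n) / 4 ^ n] times [|beta| ^ (4 n)]. *)
Let beta_power n :
  psd (fun z w => ((cb n)%:C%C - beta z ^+ (2 * n) * (beta w)^* ^+ (2 * n)) * K z w).
Proof.
have h2 : 0 <= 2^-1 :> C by rewrite invr_ge0 ler0n.
pose U z w := 2^-1 * (u z * (u w)^*); pose V z w := 2^-1 * (v z * (v w)^*).
have pU : psd U := psdZ h2 (psd_rank1 u); have pV : psd V := psdZ h2 (psd_rank1 v).
have LE z w : L z w = U z w + V z w by rewrite /L /U /V mulrC mulrDr.
have p1 : psd (fun z w => (1 - L z w ^+ (2 * n)) * K z w).
  apply: eq_psd (psd_sum (P := xpredT) (F := fun l z w => L z w ^+ l)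
    (index_enum 'I_(2 * n)) (fun l _ => psdX l pL)) => z w.
  have := subrX1 (L z w) (2 * n); rewrite -opprB => e.
  have {}e : 1 - L z w ^+ (2 * n) = (1 - L z w) * \sum_(i < 2 * n) L z w ^+ i.
    by rewrite -[LHS]opprK e -mulNr opprB.
  by rewrite e /K mulrAC divff ?mul1r.
have p2 : psd (fun z w => L z w ^+ (2 * n) -
    'C(2 * n, n)%:R * (U z w ^+ n * V z w ^+ n)).
  have hn : (n < (2 * n).+1)%N by rewrite ltnS leq_pmull.
  have bp (i : nat) : psd (fun z w => (U z w ^+ (2 * n - i) * V z w ^+ i) *+ 'C(2 * n, i)).
    apply: eq_psd (psdZ (ler0n _ 'C(2 * n, i)) (psdM (psdX (2 * n - i) pU) (psdX i pV))).
    by move=> z w; rewrite mulr_natl.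
  apply: eq_psd (psd_sum (P := fun i => i != Ordinal hn)
    (index_enum 'I_(2 * n).+1) (fun i _ => bp i)) => z w.
  have nn : (2 * n - n = n)%N by rewrite mul2n -addnn addnK.
  rewrite LE exprDn [in RHS](bigD1 (Ordinal hn)) //= nn.
  by rewrite mulr_natl addrAC subrr add0r.
have c0 : 0 <= (cb n)%:C%C by rewrite ler0c divr_ge0 ?exprn_ge0.
apply: eq_psd (psdZ c0 (psdD p1 (psdM p2 pK))) => z w.
have bn0 : 'C(2 * n, n)%:R != 0 :> C.
  by rewrite pnatr_eq0 -lt0n bin_gt0 leq_pmull.
have -> : U z w ^+ n * V z w ^+ n =
    4^-1 ^+ n * (beta z ^+ (2 * n) * (beta w)^* ^+ (2 * n)).
  have bw : (beta w)^* ^+ 2 = (u w)^* * (v w)^*.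
    by rewrite -[LHS](rmorphXn Num.conj) -beta2; apply: rmorphM.
  rewrite ![_ ^+ (2 * n)]exprM bw -beta2 /U /V.
  move: (u z) (v z) ((u w)^*) ((v w)^*) => x y x' y'.
  by rewrite -!exprMn; congr (_ ^+ n); field.
rewrite /cb fmorph_div rmorphXn !rmorph_nat /= exprVn.
move: (beta z ^+ _ * _) (L z w ^+ _) (K z w) => b l k.
have f0 : 4 ^+ n != 0 :> C by rewrite expf_neq0 // pnatr_eq0.
by move: (4 ^+ n) f0 => f f0; field; rewrite bn0 f0.
Qed.

Let inv_beta (p : R) : `|p| < 1 -> bounded_mul K (fun z => (1 + p%:C%C * beta z)^-1).
Proof. by move=> p1; apply: (bounded_mul_invX pK beta1 bbeta p1 cb_le beta_power). Qed.

(** Since [1 + a beta = (1 - a^2) / (1 - a zt)], the function [zt] is affine in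
    [1 / (1 + a beta)]. *)
Let K_zt : bounded_mul K zt.
Proof.
have ra : `|r ^+ 2| < 1 by rewrite normrX exprn_ilt1.
have h := bounded_mulD pK (bounded_mul_cst K 1) (bounded_mulZ (- (1 - a ^+ 2)) (inv_beta ra)).
apply: eq_bounded_mul (bounded_mulZ a^-1 h) => z /=.
rewrite -aE /beta; have := maz0 z; move: (zt z) => x n0.
have a20 : 1 - a ^+ 2 != 0.
  have -> : 1 - a ^+ 2 = (1 - a) * (1 + a) by ring.
  by rewrite mulf_neq0.
have -> : 1 + a * ((x - a) / (1 - a * x)) = (1 - a ^+ 2) / (1 - a * x) by field.
by field; rewrite an0 n0 a20.
Qed.

(** At the zero [zt = - 1 / a] of [theta] the function [beta] takes the value [- 1 / p], so [theta]
    divides the numerator of [1 + p beta]. That [p < 1] is [(1 - a)^2 > 0]. *)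
Let K_theta : bounded_mul K (fun z => (theta zt a z)^-1).
Proof.
pose p := 2 * r ^+ 2 / (1 + r ^+ 2 ^+ 2).
have r2 : r ^+ 2 < 1 by rewrite -ltcR -aE.
have d0 : 0 < 1 + r ^+ 2 ^+ 2 by rewrite ltr_wpDr ?exprn_even_ge0.
have p1 : `|p| < 1.
  have p0 : 0 <= p.
    by apply: divr_ge0 (ltW d0); apply: mulr_ge0 (sqr_ge0 _); rewrite ler0n.
  by rewrite ger0_norm // ltr_pdivrMr // mul1r; move: r2; move: (r ^+ 2) => x; nra.
have h := bounded_mulD pK (bounded_mul_cst K 1)
  (bounded_mulZ ((1 - a ^+ 2) / (1 + a ^+ 2)) (inv_beta p1)).
apply: eq_bounded_mul (bounded_mulZ 2^-1 h) => z /=.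
have a21 : 1 + a ^+ 2 != 0 by rewrite gt_eqF // ltr_wpDr // exprn_ge0 // ltW.
have a20 : 1 - a ^+ 2 != 0.
  have -> : 1 - a ^+ 2 = (1 - a) * (1 + a) by ring.
  by rewrite mulf_neq0.
have -> : p%:C%C = 2 * a / (1 + a ^+ 2).
  rewrite aE /p; move: (r ^+ 2) => x.
  by rewrite !(fmorph_div, rmorphM, rmorphD, rmorph1, rmorph_nat, rmorphXn).
have t0 : 1 + a * zt z != 0 by apply: (theta_neq0 a0 a1 zt1 z).
rewrite /theta /beta; have := maz0 z; move: (zt z) t0 => x t0 n0.
have -> : 1 + 2 * a / (1 + a ^+ 2) * ((x - a) / (1 - a * x)) =
  (1 - a ^+ 2) * (1 + a * x) / ((1 + a ^+ 2) * (1 - a * x)).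
  by field; rewrite n0 a21.
by field; rewrite t0 n0 a21 a20.
Qed.

Lemma norm_disc_opp z : `|- val z| < 1.
Proof. by rewrite normrN norm_disc. Qed.

Let opp z : Disc R := exist _ (- val z) (norm_disc_opp z).

Let zt_opp z : zt (opp z) = zt z. Proof. exact: sqrrN. Qed.

Let ellN0 z : ell zt a z != 0. Proof. by apply: ell_neq0 => //; apply: zt1. Qed.

(* The part of [disc_kernel] invariant under [z |-> - z] is [kEven]. *)
Let bounded_kEven f : (forall z, f (opp z) = f z) -> bounded_mul K f ->
  bounded_mul (kEven zt a) f.
Proof.
move=> fN [c c0 h]; exists c => //.
(* The [4] averages the four symmetrised terms; [1 - a] and [1 / ell] undo the factors in
   [K_disc_kernel]. *)
have q0 : 0 <= (1 - a) / 4 by rewrite divr_ge0 // subr_ge0 ltW.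
have p := psdZ q0 (psd_congr (fun z => (ell zt a z)^-1) (psd_symmetrize opp h)).
apply: eq_psd p => z w; rewrite !fN !K_disc_kernel /disc_kernel fmorphV /=.
have lN y : ell zt a (opp y) = ell zt a y by rewrite /ell zt_opp.
have tN : [/\ t (opp z) w = - t z w, t z (opp w) = - t z w
    & t (opp z) (opp w) = t z w].
  by rewrite /t /= rmorphN /= !(mulNr, mulrN) opprK.
have kN (k : Disc R -> Disc R -> C) : (forall z w, k (opp z) w = k z w) ->
    (forall z w, k z (opp w) = k z w) -> [/\ k (opp z) w = k z w,
    k z (opp w) = k z w & k (opp z) (opp w) = k z w].
  by move=> h1 h2; rewrite h1 !h2 h1.
have [e1 e2 e3] : [/\ kEven zt a (opp z) w = kEven zt a z w,
    kEven zt a z (opp w) = kEven zt a z w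
    & kEven zt a (opp z) (opp w) = kEven zt a z w].
  by apply: kN => x y; rewrite /kEven /kOdd /kP /kG /kM /kTh /theta /kX /kPi !zt_opp.
have [o1 o2 o3] : [/\ kOdd zt a (opp z) w = kOdd zt a z w,
    kOdd zt a z (opp w) = kOdd zt a z w
    & kOdd zt a (opp z) (opp w) = kOdd zt a z w].
  by apply: kN => x y; rewrite /kOdd /kG /kM /kTh /theta /kX /kPi !zt_opp.
have [p1 p2 p3] : [/\ kPi zt (opp z) w = kPi zt z w,
    kPi zt z (opp w) = kPi zt z w & kPi zt (opp z) (opp w) = kPi zt z w].
  by apply: kN => x y; rewrite /kPi !zt_opp.
have [t1 t2 t3] := tN.
rewrite !lN e1 e2 e3 o1 o2 o3 p1 p2 p3 t1 t2 t3.
have l0 := ellN0 z; have lw : (ell zt a w)^* != 0 by rewrite conjC_eq0.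
move: (kEven zt a z w) (kOdd zt a z w) (kPi zt z w) (f z * _) (t z w) (qa a) l0 lw am0.
move: (ell zt a z) ((ell zt a w)^*) (a) => l l' b e o p' ff s q l0 lw b0.
by field; rewrite l0 lw b0.
Qed.

Let bz : bounded_mul (kEven zt a) zt.
Proof. by apply: bounded_kEven K_zt => z; rewrite zt_opp. Qed.

Let bt : bounded_mul (kEven zt a) (fun z => (theta zt a z)^-1).
Proof. by apply: bounded_kEven K_theta => z; rewrite /theta zt_opp. Qed.

(** The common comparison kernel: it involves [z^2] and [t] but not [r]. *)
Definition model z w : C :=
  (kX zt z w)^-1 + t z w * (kPi zt z w * kModel zt 1 z w).

Let pt : psd t. Proof. exact: psd_rank1. Qed.

Let p_even : psd (fun z w => (kX zt z w)^-1). Proof. exact: psd_kXV zt1. Qed.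

Let p_odd : psd (fun z w => t z w * (kPi zt z w * kModel zt 1 z w)).
Proof.
apply: psdM pt (psdM (psd_kPi zt) (psdM p_even _)).
by apply: psd_kT zt1 _ _; rewrite ler01.
Qed.

Lemma psd_model : psd model.
Proof. exact: psdD. Qed.

Let q_gt0 : 0 < qa a.
Proof.
by apply: mulr_gt0; rewrite ?subr_gt0 //; apply: mulr_gt0 a0; rewrite ltr0n.
Qed.

Let psd_even := psd_kEven a0 a1 zt1 evn_sqo.
Let psd_odd : psd (fun z w => t z w * (qa a * kPi zt z w * kOdd zt a z w)).
Proof.
apply: psdM pt (psdM (psdZ (ltW q_gt0) (psd_kPi zt)) _).
exact: psd_kOdd a0 a1 zt1 evn_sqo.
Qed.

Let dom_disc_model : dom disc_kernel model.
Proof.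
apply: domD.
  exact: dom_addr p_odd (dom_kEven_Szego a0 a1 zt1 evn_sqo).
have dOdd := domM pt (domM (psd_kPi zt)
  (dom_kOdd_kModel a0 a1 zt1 evn_sqo bz ltr01)).
apply: eq_dom (dom_addr p_even (domZ (ltW q_gt0) dOdd)) => z w; first by ring.
by rewrite addrC.
Qed.

Let dom_model_disc : dom model disc_kernel.
Proof.
apply: domD.
  exact: dom_addr psd_odd (dom_Szego_kEven a0 a1 zt1 evn_sqo bz bt).
have dOdd := domM pt (domM (psd_kPi zt)
  (dom_kModel_kOdd a0 a1 zt1 evn_sqo bz bt ltr01)).
apply: eq_dom (dom_addr psd_even (domZr q_gt0 dOdd)) => z w //.
by rewrite /disc_kernel; ring.
Qed.

Lemma in_rkhs_frr f : in_rkhs (kernel_of (frr r)) f <->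
  in_rkhs model (fun z => (ell zt a z)^-1 * f z).
Proof.
have eK : kernel_of (frr r) = K.
  by apply/funext => z; apply/funext => w; apply: kernel_of_frr.
pose k z w := ell zt a z * (ell zt a w)^* * model z w.
have am1 : 0 < (1 - a)^-1 by rewrite invr_gt0 subr_gt0.
have pk : psd k := psd_congr _ psd_model.
have pl := psd_rank1 (ell zt a).
have dKk : dom K k.
  apply: eq_dom (domZ (ltW am1) (domM pl dom_disc_model)) => z w //.
  by rewrite K_disc_kernel mulrA.
have dkK : dom k K.
  apply: eq_dom (domZr am1 (domM pl dom_model_disc)) => z w //.
  by rewrite K_disc_kernel mulrA.
rewrite eK; split=> [/(in_rkhs_dom pK dKk)|] h.
  have := in_rkhs_scale (fun z => (ell zt a z)^-1) h; apply: eq_in_rkhs => // z w.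
  rewrite /k fmorphV /= mulrA mulrACA !mulVf ?conjC_eq0 ?ellN0 //.
  by rewrite !mul1r.
apply: (in_rkhs_dom pk dkK); have := in_rkhs_scale (ell zt a) h.
by apply: eq_in_rkhs => // z; rewrite mulrA divff ?mul1r.
Qed.

(** The dependence on [r] left in [in_rkhs_frr] is the nonvanishing factor [1 / ell]; it commutes
    with multiplication by [phi]. *)
Lemma Mult_frr phi : Mult (frr r) phi <-> multiplier model phi.
Proof.
have e (f : Disc R -> C) : f = (fun z => (ell zt a z)^-1 * (ell zt a z * f z)).
  by apply/funext => z; rewrite mulKf // ellN0.
split=> h f hf.
  have : in_rkhs (kernel_of (frr r)) (fun z => ell zt a z * f z).
    by apply/in_rkhs_frr; rewrite -e.
  move=> /h /in_rkhs_frr; congr (in_rkhs _ _); apply/funext => z.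
  by rewrite [X in _ * X]mulrCA mulKf // ellN0.
apply/in_rkhs_frr; move/in_rkhs_frr/h: hf; congr (in_rkhs _ _).
by apply/funext => z; rewrite mulrCA.
Qed.

End DiscKernel.

Unset Implicit Arguments.
Local Open Scope complex_scope.

Theorem theorem1p7 (R : realType) (r s : R) :
  -1 < r < 0 -> -1 < s < 0 ->
  (alg_isomorphic (Mult (frr r)) (Mult (frr s)) <->
   (forall phi : Disc R -> R[i], Mult (frr r) phi <-> Mult (frr s) phi)).
Proof.
have h (x : R) : -1 < x < 0 -> x != 0 /\ `|x| < 1.
  move=> /andP[x1 x0]; split; first by rewrite lt_eqF.
  by rewrite ltr_norml x1 (lt_trans x0).
move=> /h[r0 r1] /h[s0 s1]; split=> [_ phi | e].
  exact: iff_trans (Mult_frr r0 r1 phi) (iff_sym (Mult_frr s0 s1 phi)).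
exists id; split=> // [phi|chi]; first by rewrite e.
by rewrite -e => ?; exists chi.
Qed.
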